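(* Let $T$ be a closed normal operator on a complex Hilbert space $H$ and let $A$ be a linear operator on $H$ with $\mathcal D(T)\subseteq\mathcal D(A)$ such that, for some constants $a\ge 0$ and $0\le b<1$, $\|Ax\|^2\le a^2\|x\|^2+b^2\|Tx\|^2$ for all $x\in\mathcal D(T)$. Assume that $\sigma(T)\subseteq\{z\in\mathbb C:\gamma_1\le\operatorname{Im} z\le\gamma_2\}$ for some real $\gamma_1<\gamma_2$, and set $\widetilde\gamma=\max\{|\gamma_1|,|\gamma_2|\}$. Assume in addition that there are unbounded real sequences $(\alpha_n)_{n\in\mathbb N}$ and $(\beta_n)_{n\in\mathbb N}$ such that $\alpha_n<\beta_n\le\alpha_{n+1}$ and $\{z\in\mathbb C:\alpha_n<\operatorname{Re} z<\beta_n\}\subseteq\rho(T)$ for every $n$. Put $$q_n=\frac{\sqrt{a^2+b^2\widetilde\gamma^2+b^2\alpha_n^2}+\sqrt{a^2+b^2\widetilde\gamma^2+b^2\beta_n^2}}{\beta_n-\alpha_n}.$$ (i) If $\liminf_{n\to\infty}q_n<1$, then the resolvent set of $T+A$ contains infinitely many strips parallel to the imaginary axis, in the sense that for infinitely many $n$ there is a nonempty open strip $\{z:\alpha<\operatorname{Re} z<\beta\}\subseteq\rho(T+A)$ with $\alpha_n\le\alpha<\beta\le\beta_n$. If $b=0$, then $\liminf_{n\to\infty}q_n<1$ holds if and only if $\limsup_{n\to\infty}(\beta_n-\alpha_n)>2a$; if $0<b<1$, it holds if and only if $$\limsup_{n\to\infty}\frac{\beta_n}{\alpha_n}>\frac{1+b}{1-b}.$$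 (ii) If $\limsup_{n\to\infty}q_n<1$, then at most finitely many of the spectral gaps of $T$ close, i.e. for all but finitely many $n$ there is a nonempty open strip $\{z:\alpha<\operatorname{Re} z<\beta\}\subseteq\rho(T+A)$ with $\alpha_n\le\alpha<\beta\le\beta_n$. If $b=0$, then $\limsup_{n\to\infty}q_n<1$ holds if and only if $\liminf_{n\to\infty}(\beta_n-\alpha_n)>2a$; if $0<b<1$, it holds if and only if $$\liminf_{n\to\infty}\frac{\beta_n}{\alpha_n}>\frac{1+b}{1-b}.$$
   Context: $\mathcal D(S)$ denotes the domain of an operator $S$. A closed densely defined operator $T$ on $H$ is normal if $TT^*=T^*T$. The operator $T+A$ has domain $\mathcal D(T)$. The resolvent set $\rho(S)$ is the set of $z\in\mathbb C$ such that $S-z:\mathcal D(S)\to H$ is bijective with bounded inverse; $\sigma(S)=\mathbb C\setminus\rho(S)$. Limits superior and inferior take values in $[-\infty,\infty]$; note $\alpha_n\to+\infty$, so $\beta_n/\alpha_n$ is defined for all large $n$.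
   Formalization: For b=0, the implications from liminf q_n<1 to limsup(β_n−α_n)>2a and from limsup q_n<1 to liminf(β_n−α_n)>2a are stated only for a>0; at a=b=0 they fail, since then q_n=0 for all n while the gap lengths β_n−α_n may tend to 0. *)

(* Defs.v *)
From HB Require Import structures.
From mathcomp Require Import all_boot all_order all_algebra.
From mathcomp Require Import sesquilinear.
From mathcomp Require Import complex.
From mathcomp Require Import all_classical all_reals all_analysis.

Set Implicit Arguments.
Unset Strict Implicit.
Unset Printing Implicit Defensive.

Import Order.TTheory GRing.Theory Num.Theory.
Import numFieldNormedType.Exports.

Local Open Scope classical_set_scope.
Local Open Scope complex_scope.
Local Open Scope ring_scope.

(* A complex Hilbert space is a complete normed space over R[i] whose norm comes
   from an inner product; `ip` is linear in its first argument and
   conjugate-linear in its second one. *)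
Definition inner_product_norm (R : realType) (H : completeNormedModType R[i])
    (ip : {dot H for (@Num.conj R[i])}) : Prop :=
  forall x : H, `|x| ^+ 2 = ip x x.

(* Possibly unbounded operators: `op_fun` is total, but only its values on `dom`
   are meaningful. *)
Record operator (R : realType) (H : completeNormedModType R[i]) := Operator {
  dom : set H;
  op_fun :> H -> H }.

Section Operators.
Variables (R : realType) (H : completeNormedModType R[i]).
Implicit Types S T : operator H.

Definition linear_op S : Prop :=
  dom S 0 /\
  forall (c : R[i]) (x y : H), dom S x -> dom S y ->
    dom S (c *: x + y) /\ S (c *: x + y) = c *: S x + S y.

Definition eq_op S T : Prop :=
  dom S = dom T /\ forall x, dom S x -> S x = T x.

Definition graph S : set (H * H) := [set p | dom S p.1 /\ p.2 = S p.1].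

Definition closed_op S : Prop := closed (graph S).

Definition densely_defined S : Prop := dense (dom S).

Definition comp_op S T : operator H :=
  Operator [set x | dom T x /\ dom S (T x)] (fun x => S (T x)).

(* The domain is that of S; this is the operator sum when dom S `<=` dom T. *)
Definition add_op S T : operator H :=
  Operator (dom S) (fun x => S x + T x).

Definition adjoint_values (ip : H -> H -> R[i]) S (y : H) : set H :=
  [set z | forall x, dom S x -> ip (S x) y = ip x z].

(* When S is densely defined, adjoint_values ip S y has at most one element, so
   that the choice made by `xget` is immaterial. *)
Definition adjoint_op (ip : H -> H -> R[i]) S : operator H :=
  Operator [set y | adjoint_values ip S y !=set0]
           (fun y => xget 0 (adjoint_values ip S y)).

Definition normal_op (ip : H -> H -> R[i]) T : Prop :=
  [/\ linear_op T, closed_op T, densely_defined T &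
      eq_op (comp_op T (adjoint_op ip T)) (comp_op (adjoint_op ip T) T)].

(* `g` is the inverse of the bijection S - z : dom S -> H. *)
Definition resolvent_set S : set R[i] :=
  [set z | exists g : H -> H,
     [/\ forall y, dom S (g y) /\ S (g y) - z *: g y = y,
         forall x, dom S x -> g (S x - z *: x) = x
       & exists M : R, forall y, `|g y| <= M%:C * `|y|]].

Definition spectrum S : set R[i] := ~` resolvent_set S.

End Operators.

Definition vstrip (R : realType) (s t : R) : set R[i] :=
  [set z | s < complex.Re z < t].

Definition has_resolvent_strip (R : realType) (H : completeNormedModType R[i])
    (S : operator H) (s t : R) : Prop :=
  exists s' t' : R,
    [/\ s <= s', s' < t', t' <= t & vstrip s' t' `<=` resolvent_set S].

Definition gap_ratio (R : realType) (a b g s t : R) : R :=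
  (Num.sqrt (a ^+ 2 + b ^+ 2 * g ^+ 2 + b ^+ 2 * s ^+ 2) +
   Num.sqrt (a ^+ 2 + b ^+ 2 * g ^+ 2 + b ^+ 2 * t ^+ 2)) / (t - s).

(* Main.v *)
Require Import Defs.
From HB Require Import structures.
From mathcomp Require Import all_boot all_order all_algebra.
From mathcomp Require Import sesquilinear.
From mathcomp Require Import complex.
From mathcomp Require Import all_classical all_reals all_analysis.
From mathcomp Require Import ring lra.

Set Implicit Arguments.
Unset Strict Implicit.
Unset Printing Implicit Defensive.

Import Order.TTheory GRing.Theory Num.Theory.
Import numFieldNormedType.Exports.

Local Open Scope classical_set_scope.
Local Open Scope complex_scope.
Local Open Scope ring_scope.

(** The theorem has two independent halves: an operator-theoretic criterion for
    a vertical line to stay in the resolvent set, and the asymptotics of the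
    ratios q_n.

    Criterion.  Let f(m) = sqrt(a^2 + b^2 gamma^2 + b^2 m^2).  If q_n < 1, then
    alpha_n + f(alpha_n) < beta_n - f(beta_n), and every z whose real part lies
    strictly between these numbers belongs to the resolvent set of T + A.
    Indeed, the function f is b-Lipschitz with b < 1, so every spectral point l
    of T satisfies |l - z|^2 > k^2 (a^2 + b^2 |l|^2) for some k > 1 ([gap_margin],
    [gap_survives]).  If the spectral theorem were applied to this inequality
    of functions of l, it would give
    k |A x| <= |(T - z) x|, so that A (T - z)^-1 is a strict contraction and
    T + A - z = (1 + A (T - z)^-1) (T - z) is inverted by iteration
    ([resolvent_perturb]).

    The spectral theorem can be replaced by one of its simplest consequences.
    Completing the square in l turns the inequality above into |l - z'| > r,
    with z' = z / (1 - k^2 b^2) and r independent of l; the very same algebra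
    turns the desired estimate into |(T - z') x| >= r |x|
    ([relbound_resolvent]).  Hence only the bound |(T - z') x| >= r |x| is
    needed when the closed disc of radius r about z' lies in the resolvent set
    of a normal operator T ([normal_resolvent_bound]): the norm of the resolvent
    is the inverse of the distance to the spectrum.

    That bound is proved by elementary means.  Let g be the resolvent at z', let
    s be its norm, and suppose that the circle of radius 1/s about z' lies in
    the resolvent set; by compactness one constant c > 0 satisfies
    c |x| <= |(T - l) x| for all l on this circle.  For w^n = 1 the vector u_w,
    the sum over k < n of (w/s)^k g^(k+1) y, satisfies (T - z' - w/s) u_w = y - s^-n g^n y, so
    c |u_w| <= 2 |y|.  Averaging |u_w|^2 over the n-th roots of unity
    ([parseval]) bounds the sum over k < n of s^(-2k) |g^(k+1) y|^2 by
    4 |y|^2 / c^2.  But T is normal, so |g y|^2 <= |g (g y)| |y|: the quotients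
    |g^(k+1) y| / |g^k y| increase with k, and if the first one is close to s
    then all n terms are close to s^2 |y|^2, which is absurd for large n
    ([normal_circle_meets_spectrum]).

    The inequality |g y|^2 <= |g (g y)| |y| would follow at once from
    |(T - z)^* v| = |(T - z) v|.  This identity is immediate for v in the domain
    of T^* T, and von Neumann's argument (orthogonal projections in the graph of
    T) shows that this domain is a core for T ([graph_projection],
    [normal_shift_sqr]).

    Asymptotics.  As alpha_n tends to infinity, f(m) lies between b |m| and
    f(0) + b |m|, so that q_n behaves like b (t + 1) / (t - 1) with
    t = beta_n / alpha_n, and this is less than 1 exactly when
    t > (1 + b) / (1 - b).  If b = 0, then q_n = 2 a / (beta_n - alpha_n).
    Limits superior and inferior are handled through their characterizations
    by quantifiers ([limn_esup_gtP] and its variants). *)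

(** * Real-valued norm and inner product *)

Section RealNorm.
Variable R : realType.

(** Norms over [R[i]] are nonnegative elements of [R[i]]; their real parts live in
    the ordered field [R], where decision procedures for inequalities apply. *)
Definition nrm (V : normedZmodType R[i]) (x : V) : R := complex.Re `|x|.

Lemma nrmE (V : normedZmodType R[i]) (x : V) : `|x| = (nrm x)%:C.
Proof. by rewrite /nrm RRe_real. Qed.

Lemma nrm_ge0 (V : normedZmodType R[i]) (x : V) : 0 <= nrm x.
Proof. by rewrite -ler0c -nrmE. Qed.

Lemma nrm0 (V : normedZmodType R[i]) : nrm (0 : V) = 0.
Proof. by apply: complexI; rewrite -nrmE normr0. Qed.

Lemma nrm_eq0 (V : normedZmodType R[i]) (x : V) : (nrm x == 0) = (x == 0).
Proof. by rewrite -[RHS]normr_eq0 nrmE -[LHS](inj_eq (@complexI R)). Qed.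

Lemma nrmN (V : normedZmodType R[i]) (x : V) : nrm (- x) = nrm x.
Proof. by rewrite /nrm normrN. Qed.

Lemma nrmBC (V : normedZmodType R[i]) (x y : V) : nrm (x - y) = nrm (y - x).
Proof. by rewrite /nrm distrC. Qed.

Lemma nrmD (V : normedZmodType R[i]) (x y : V) : nrm (x + y) <= nrm x + nrm y.
Proof. by rewrite -lecR rmorphD/= -!nrmE ler_normD. Qed.

Lemma nrmB (V : normedZmodType R[i]) (x y : V) : nrm (x - y) <= nrm x + nrm y.
Proof. by rewrite -(nrmN y) nrmD. Qed.

Lemma nrm_triB (V : normedZmodType R[i]) (y x z : V) :
  nrm (x - z) <= nrm (x - y) + nrm (y - z).
Proof. by rewrite -[x - z](subrKA y) nrmD. Qed.

Lemma nrmZ (V : normedModType R[i]) (c : R[i]) (x : V) :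
  nrm (c *: x) = nrm c * nrm x.
Proof. by apply: complexI; rewrite rmorphM/= -!nrmE normrZ. Qed.

Lemma nrmM (c d : R[i]) : nrm (c * d) = nrm c * nrm d.
Proof. by apply: complexI; rewrite rmorphM/= -!nrmE normrM. Qed.

Lemma nrmX (c : R[i]) n : nrm (c ^+ n) = nrm c ^+ n.
Proof. by apply: complexI; rewrite rmorphXn/= -!nrmE normrX. Qed.

Lemma nrmC (t : R) : nrm t%:C = `|t|.
Proof.
by apply: complexI; rewrite -nrmE normc_def/= expr0n/= addr0 sqrtr_sqr.
Qed.

Lemma nrm_sqr (c : R[i]) : nrm c ^+ 2 = complex.Re c ^+ 2 + complex.Im c ^+ 2.
Proof. by apply: complexI; rewrite rmorphXn/= -nrmE add_Re2_Im2. Qed.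

Lemma gt0_realC (e : R[i]) : 0 < e -> exists2 r : R, 0 < r & e = r%:C.
Proof.
move=> e0; exists (complex.Re e).
  by case: e e0 => p q /=; rewrite ltcE/= => /andP[].
by rewrite RRe_real ?gtr0_real.
Qed.

Lemma nrm_le_ReIm (c : R[i]) : nrm c <= `|complex.Re c| + `|complex.Im c|.
Proof.
rewrite -(ler_pXn2r (ltn0Sn 1)) ?nnegrE ?nrm_ge0 ?addr_ge0//.
rewrite nrm_sqr sqrrD !real_normK ?num_real// -addrA lerD2l lerDr.
by rewrite mulrn_wge0 ?mulr_ge0.
Qed.

End RealNorm.

Section RealInnerProduct.
Variables (R : realType) (H : completeNormedModType R[i]).
Variable ip : {dot H for (@Num.conj R[i])}.
Hypothesis hip : inner_product_norm ip.

Definition rip (x y : H) : R := complex.Re (ip x y).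

Lemma ripC x y : rip x y = rip y x.
Proof.
rewrite /rip hermC /= expr0 mul1r.
by case: (ip y x).
Qed.

Lemma ripDl x y z : rip (x + y) z = rip x z + rip y z.
Proof. by rewrite /rip linearDl raddfD. Qed.

Lemma ripNl x y : rip (- x) y = - rip x y.
Proof. by rewrite /rip linearNl raddfN. Qed.

Lemma ripBl x y z : rip (x - y) z = rip x z - rip y z.
Proof. by rewrite ripDl ripNl. Qed.

Lemma ripDr x y z : rip z (x + y) = rip z x + rip z y.
Proof. by rewrite !(ripC z) ripDl. Qed.

Lemma ripNr x y : rip y (- x) = - rip y x.
Proof. by rewrite !(ripC y) ripNl. Qed.

Lemma ripBr x y z : rip z (x - y) = rip z x - rip z y.
Proof. by rewrite !(ripC z) ripBl. Qed.

Lemma ripZl (t : R) x y : rip (t%:C *: x) y = t * rip x y.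
Proof.
rewrite /rip linearZl_LR/=; case: (ip x y) => u v /=.
by rewrite mul0r subr0.
Qed.

Lemma ripZr (t : R) x y : rip y (t%:C *: x) = t * rip y x.
Proof. by rewrite !(ripC y) ripZl. Qed.

Lemma ripJ (c : R[i]) x y : rip (c *: x) y = rip x (Num.conj c *: y).
Proof. by rewrite /rip linearZl_LR linearZr_LR/= conjCK. Qed.

Lemma rip_sqr x : rip x x = nrm x ^+ 2.
Proof. by apply: complexI; rewrite rmorphXn/= -nrmE hip /rip RRe_real// ger0_real. Qed.

Lemma nrm_sqrD x y : nrm (x + y) ^+ 2 = nrm x ^+ 2 + 2 * rip x y + nrm y ^+ 2.
Proof. by rewrite -!rip_sqr ripDl !ripDr (ripC y x); ring. Qed.

Lemma nrm_sqrB x y : nrm (x - y) ^+ 2 = nrm x ^+ 2 - 2 * rip x y + nrm y ^+ 2.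
Proof. by rewrite nrm_sqrD nrmN ripNr; ring. Qed.

Lemma rip_le x y : rip x y <= nrm x * nrm y.
Proof.
have [->|x0] := eqVneq x 0.
  by rewrite nrm0 mul0r -(subrr 0) ripBl subrr.
have [->|y0] := eqVneq y 0.
  by rewrite nrm0 mulr0 -(subrr 0) ripBr subrr.
have xp : 0 < nrm x by rewrite lt_neqAle eq_sym nrm_eq0 x0 nrm_ge0.
have yp : 0 < nrm y by rewrite lt_neqAle eq_sym nrm_eq0 y0 nrm_ge0.
have := sqr_ge0 (nrm ((nrm y)%:C *: x - (nrm x)%:C *: y)).
rewrite nrm_sqrB !nrmZ ripZl ripZr !nrmC !ger0_norm ?nrm_ge0// => h.
rewrite -subr_ge0 -(pmulr_rge0 _ (mulr_gt0 xp yp)).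
by rewrite -(pmulr_rge0 _ (ltr0n R 2)); lra.
Qed.

(** The imaginary part of an inner product is recovered by multiplying the left
    argument by the imaginary unit; hence domains stable under complex scalars
    can be handled with [rip] alone. *)
Lemma rip_eq_ip x y x' y' :
  (forall c : R[i], rip (c *: x) y = rip (c *: x') y') -> ip x y = ip x' y'.
Proof.
move=> h; have := h 1; rewrite !scale1r /rip => h1.
have := h 'i%C; rewrite /rip !linearZl_LR/=.
case: (ip x y) h1 => a b; case: (ip x' y') => c d /= ->.
by rewrite !mul0r !mul1r !sub0r => /oppr_inj ->.
Qed.

Lemma cauchy_limit (x : nat -> H) :
  (forall e : R, 0 < e -> exists N, forall m n, (N <= m)%N -> (N <= n)%N ->
     nrm (x m - x n) < e) ->
  exists l, forall e : R, 0 < e -> exists N, forall n, (N <= n)%N ->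
     nrm (x n - l) < e.
Proof.
move=> hx.
have /cauchy_cvgP cx : cauchy (x @ \oo).
  apply/cauchy_ballP => e /gt0_realC[r r0 ->].
  have [N hN] := hx r r0.
  rewrite near_map2.
  exists ([set n | (N <= n)%N], [set n | (N <= n)%N]); first by split; exists N.
  move=> -[m n] /= [hm hn]; rewrite -ball_normE /ball_/= nrmE ltcR.
  exact: hN.
exists (lim (x @ \oo)) => e e0.
have /cvgrPdist_lt/(_ e%:C) := cx.
rewrite ltcR => /(_ e0) [N _ hN]; exists N => n Nn.
have := hN n Nn; rewrite nrmE ltcR.
by rewrite nrmBC.
Qed.

End RealInnerProduct.

(** * Closed operators and projection onto a graph *)

Section LinearOperator.
Variables (R : realType) (H : completeNormedModType R[i]) (T : operator H).
Hypothesis linT : linear_op T.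

Lemma op0 : T 0 = 0.
Proof.
case: linT => d0 /(_ (-1) 0 0 d0 d0)[_].
by rewrite scaler0 addr0 scaleN1r addNr.
Qed.

Lemma opZ c x : dom T x -> dom T (c *: x) /\ T (c *: x) = c *: T x.
Proof.
move=> dx; case: linT => d0 /(_ c x 0 dx d0).
by rewrite op0 !addr0.
Qed.

Lemma opD x y : dom T x -> dom T y -> dom T (x + y) /\ T (x + y) = T x + T y.
Proof. by move=> dx dy; case: linT => _ /(_ 1 x y dx dy); rewrite !scale1r. Qed.

Lemma opB x y : dom T x -> dom T y -> dom T (x - y) /\ T (x - y) = T x - T y.
Proof.
move=> dx dy; have [dNy Ty] := opZ (-1) dy; have [] := opD dx dNy.
by rewrite Ty !scaleN1r.
Qed.

Lemma closed_graph_limit l1 l2 : closed_op T ->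
  (forall e : R, 0 < e -> exists x, [/\ dom T x, nrm (x - l1) < e & nrm (T x - l2) < e]) ->
  dom T l1 /\ T l1 = l2.
Proof.
move=> clT h; suff /clT[/= d1 ->] : closure (graph T) (l1, l2) by [].
move=> B /nbhs_ballP[_ /gt0_realC[e e0 ->] eB].
have [x [dx xl1 xl2]] := h _ e0.
exists (x, T x); split; first by split.
by apply: eB; split => /=; rewrite -ball_normE /ball_/= nrmE ltcR nrmBC.
Qed.

End LinearOperator.

Section GraphProjection.
Variables (R : realType) (H : completeNormedModType R[i]).
Variable ip : {dot H for (@Num.conj R[i])}.
Hypothesis hip : inner_product_norm ip.
Variable T : operator H.
Hypotheses (linT : linear_op T) (clT : closed_op T).
Variable D : set H.
Hypotheses (DT : D `<=` dom T) (D0 : D 0)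
  (Dlin : forall c x y, D x -> D y -> D (c *: x + y)).
Variables v1 v2 : H.

Let dist2 x := nrm (v1 - x) ^+ 2 + nrm (v2 - T x) ^+ 2.

Let Tlin c x y : D x -> D y -> T (c *: x + y) = c *: T x + T y.
Proof. by move=> Dx Dy; case: linT => _ /(_ c x y (DT Dx) (DT Dy))[]. Qed.

Let m : R := inf [set dist2 x | x in D].

Let dist2_ge x : D x -> m <= dist2 x.
Proof.
move=> Dx; apply: ge_inf; last by exists x.
by exists 0 => _ [y _ <-]; rewrite addr_ge0 ?sqr_ge0.
Qed.

Let dist2_lt (e : R) : 0 < e -> exists2 x, D x & dist2 x < m + e.
Proof.
move=> e0.
have [|_ [x Dx <-] xe] := @inf_adherent _ [set dist2 x | x in D] _ e0.
  split; first by exists (dist2 0); exists 0.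
  by exists 0 => _ [y _ <-]; rewrite addr_ge0 ?sqr_ge0.
by exists x.
Qed.

(** Parallelogram law: two nearly closest points are close to each other, since
    their midpoint is no closer than the infimum. *)
Let dist2_cauchy e x y : D x -> D y -> dist2 x < m + e -> dist2 y < m + e ->
  nrm (x - y) ^+ 2 + nrm (T x - T y) ^+ 2 <= 4 * e.
Proof.
move=> Dx Dy xe ye.
have half : (2^-1 : R)%:C + (2^-1)%:C = 1 :> R[i].
  by rewrite -rmorphD/= -mulr2n -[X in X *+ 2]mulr1 -mulrnAr mulVf// pnatr_eq0.
pose h := (2^-1 : R)%:C.
have Dh z : D z -> D (h *: z) /\ T (h *: z) = h *: T z.
  move=> Dz; rewrite -[h *: z]addr0; split; first exact: Dlin.
  by rewrite Tlin// (op0 linT) addr0.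
have [Dhy Thy] := Dh _ Dy.
have := dist2_ge (Dlin h Dx Dhy); rewrite /dist2 Tlin// Thy => mid.
have P (a b c : H) : nrm (a - (h *: b + h *: c)) ^+ 2 =
    2^-1 * nrm (a - b) ^+ 2 + 2^-1 * nrm (a - c) ^+ 2 - 4^-1 * nrm (b - c) ^+ 2.
  have -> : a - (h *: b + h *: c) = h *: ((a - b) + (a - c)).
    by rewrite scalerDr !scalerBr opprD addrACA -scalerDl half scale1r.
  have -> : b - c = (a - c) - (a - b).
    by rewrite opprB [RHS]addrC subrKA.
  rewrite nrmZ nrmC ger0_norm ?invr_ge0// exprMn.
  move: (a - b) (a - c) => p q.
  rewrite (nrm_sqrD hip) (nrm_sqrB hip) (ripC ip q).
  by field.
move: mid xe ye; rewrite !P /dist2; lra.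
Qed.

(** The pair [(u, T u)] is the orthogonal projection of [(v1, v2)] onto the
    closure of the graph of [T] restricted to [D]; this closure stays inside the
    graph of [T] because [T] is closed. *)
Lemma graph_projection : exists u, [/\ dom T u,
  forall e : R, 0 < e -> exists x, [/\ D x, nrm (x - u) < e & nrm (T x - T u) < e]
  & forall x, D x -> rip ip (v1 - u) x + rip ip (v2 - T u) (T x) = 0].
Proof.
have eps n : 0 < n.+1%:R^-1 :> R by rewrite invr_gt0.
have /choice[x hx] n : exists x, D x /\ dist2 x < m + n.+1%:R^-1.
  by have [x] := dist2_lt (eps n); exists x.
have small (e : R) : 0 < e -> exists N, forall n, (N <= n)%N -> n.+1%:R^-1 < e.
  move=> e0; exists (Num.truncn e^-1) => n Nn.
  rewrite invf_plt ?posrE//; apply: lt_le_trans (truncnS_gt _) _.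
  by rewrite ler_nat ltnS.
have cau (e : R) : 0 < e -> exists N, forall i j, (N <= i)%N -> (N <= j)%N ->
    nrm (x i - x j) ^+ 2 + nrm (T (x i) - T (x j)) ^+ 2 < e ^+ 2.
  move=> e0; have [|N hN] := small (e ^+ 2 / 8).
    by rewrite divr_gt0 ?exprn_gt0.
  exists N => i j Ni Nj.
  have xlt k : (N <= k)%N -> dist2 (x k) < m + e ^+ 2 / 8.
    by move=> Nk; apply: lt_trans (hx k).2 _; rewrite ltrD2l hN.
  have := dist2_cauchy (hx i).1 (hx j).1 (xlt _ Ni) (xlt _ Nj).
  have : 0 < e ^+ 2 by rewrite exprn_gt0.
  by lra.
have [l1 hl1] : exists l, forall e : R, 0 < e -> exists N, forall n, (N <= n)%N ->
    nrm (x n - l) < e.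
  apply: cauchy_limit => e e0; have [N hN] := cau e e0; exists N => i j Ni Nj.
  rewrite -(ltr_pXn2r (ltn0Sn 1)) ?nnegrE ?nrm_ge0 ?ltW//.
  by have := hN _ _ Ni Nj; have := sqr_ge0 (nrm (T (x i) - T (x j))); lra.
have [l2 hl2] : exists l, forall e : R, 0 < e -> exists N, forall n, (N <= n)%N ->
    nrm (T (x n) - l) < e.
  apply: (@cauchy_limit _ _ (fun n => T (x n))) => e e0.
  have [N hN] := cau e e0; exists N => i j Ni Nj.
  rewrite -(ltr_pXn2r (ltn0Sn 1)) ?nnegrE ?nrm_ge0 ?ltW//.
  by have := hN _ _ Ni Nj; have := sqr_ge0 (nrm (x i - x j)); lra.
have appr (e : R) : 0 < e -> exists y, [/\ D y, dist2 y < m + e,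
    nrm (y - l1) < e & nrm (T y - l2) < e].
  move=> e0; have [N1 h1] := hl1 e e0; have [N2 h2] := hl2 e e0.
  have [N3 h3] := small e e0; pose n := maxn N1 (maxn N2 N3).
  exists (x n); split; first exact: (hx n).1.
  - by apply: lt_trans (hx n).2 _; rewrite ltrD2l h3// /n !leq_max leqnn !orbT.
  - by rewrite h1// leq_maxl.
  - by rewrite h2// /n !leq_max leqnn !orbT.
have [du Tu] : dom T l1 /\ T l1 = l2.
  apply: closed_graph_limit => // e /appr[y [Dy _ y1 y2]].
  by exists y; split=> //; exact: DT.
exists l1; split => //.
  by move=> e /appr[y [Dy _ y1 y2]]; exists y; rewrite Tu.
rewrite Tu => y Dy; set c := _ + _.
pose s := nrm y ^+ 2 + nrm (T y) ^+ 2.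
have s0 : 0 <= s by rewrite addr_ge0 ?sqr_ge0.
(* First variation: moving from the projection in the direction [y] cannot
   decrease the distance. *)
have key (t : R) : 2 * t * c <= t ^+ 2 * s.
  pose M := 1 + 2 * `|t| * (nrm y + nrm (T y)).
  have M1 : 1 <= M by rewrite lerDl !mulr_ge0 ?addr_ge0 ?nrm_ge0.
  have M0 : 0 < M by rewrite (lt_le_trans ltr01).
  apply/ler_addgt0Pr => e e0.
  have [z [Dz zm z1 z2]] := appr (e / M) (divr_gt0 e0 M0).
  have := dist2_ge (Dlin t%:C Dy Dz).
  rewrite /dist2 Tlin// ![t%:C *: _ + _]addrC !opprD !addrA.
  rewrite (nrm_sqrB hip (v1 - z)) (nrm_sqrB hip (v2 - T z)).
  rewrite !ripZr !nrmZ !nrmC !exprMn !real_normK ?num_real// => hm.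
  have hc (v a b w : H) : nrm (a - w) < e / M ->
      t * rip ip (v - w) b <= t * rip ip (v - a) b + `|t| * (e / M) * nrm b.
    move=> aw; have -> : v - w = (v - a) + (a - w) by rewrite subrKA.
    rewrite ripDl [t * _]mulrDr lerD2l -ripZl.
    apply: le_trans (rip_le hip _ _) _; rewrite nrmZ nrmC ler_wpM2r ?nrm_ge0//.
    by rewrite ler_wpM2l// ltW.
  have c1 := hc v1 z y l1 z1; have c2 := hc v2 (T z) (T y) l2 z2.
  have eM : e = e / M + 2 * (`|t| * (e / M) * nrm y + `|t| * (e / M) * nrm (T y)).
    rewrite -{1}[e](divfK (lt0r_neq0 M0)) /M; ring.
  move: zm; rewrite /dist2 => zm.
  by rewrite eM /c /s; lra.
(* The choice t = c / (s + 1) in [key] forces c = 0. *)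
have : 2 * c ^+ 2 * (s + 1) <= c ^+ 2 * s.
  have s1 : 0 < s + 1 by rewrite ltr_wpDl.
  have := key (c / (s + 1)).
  rewrite -(ler_pM2r (exprn_gt0 2 s1)).
  have -> : 2 * (c / (s + 1)) * c * (s + 1) ^+ 2 = 2 * c ^+ 2 * (s + 1).
    by field; exact: lt0r_neq0.
  have -> // : (c / (s + 1)) ^+ 2 * s * (s + 1) ^+ 2 = c ^+ 2 * s.
  by field; exact: lt0r_neq0.
have c20 := sqr_ge0 c; have cs0 : 0 <= c ^+ 2 * s by rewrite mulr_ge0.
move=> h; apply/eqP; rewrite -sqrf_eq0 eq_le c20 andbT.
by lra.
Qed.

End GraphProjection.

(** * Normal operators and their adjoints *)

Section NormalOperator.
Variables (R : realType) (H : completeNormedModType R[i]).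
Variable ip : {dot H for (@Num.conj R[i])}.
Hypothesis hip : inner_product_norm ip.
Variable T : operator H.
Hypothesis normT : normal_op ip T.

Let linT : linear_op T. Proof. by case: normT. Qed.

Let clT : closed_op T. Proof. by case: normT. Qed.

Local Notation Tadj := (adjoint_op ip T).

Lemma adjoint_rip y x : dom Tadj y -> dom T x -> rip ip (T x) y = rip ip x (Tadj y).
Proof. by move=> dy dx; rewrite /rip (xgetPex 0 dy x dx). Qed.

Let domTsT := dom (comp_op Tadj T).

Let domTsT_adj x : domTsT x -> [/\ dom T x, dom Tadj x & nrm (Tadj x) = nrm (T x)].
Proof.
case: normT => _ _ _ [Edom Eval] dsx.
have : dom (comp_op T Tadj) x by rewrite Edom.
move=> /[dup] /Eval Ex [dx dTx]; case: (dsx) => dTx' ddsx; split=> //.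
apply/eqP; rewrite -(eqrXn2 (ltn0Sn 1)) ?nrm_ge0// -!(rip_sqr hip).
by rewrite -(adjoint_rip dx dTx) [T _]Ex ripC -(adjoint_rip ddsx dTx').
Qed.

Let domTsT_lin c x y : domTsT x -> domTsT y -> domTsT (c *: x + y).
Proof.
move=> [dx [x' hx']] [dy [y' hy']]; have [_ /(_ c x y dx dy) [d E]] := linT.
split=> //; exists (c *: x' + y') => z dz.
by rewrite E !linearDr !linearZr_LR/= (hx' z)// (hy' z).
Qed.

(** The operator 1 + T^* T is onto: project [(y, 0)] onto the graph of [T]. *)
Let domTsT_surj y : exists2 x, domTsT x & forall z, dom T z ->
  rip ip (T x) (T z) = rip ip (y - x) z.
Proof.
have [//|||u [du _ hu]] := @graph_projection _ _ _ hip _ linT clT (dom T) _ _ _ y 0.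
- by case: linT.
- by move=> c x z dx dz; case: linT => _ /(_ c x z dx dz)[].
have hu' z : dom T z -> rip ip (T u) (T z) = rip ip (y - u) z.
  by move=> /hu; rewrite sub0r ripNl => /eqP; rewrite subr_eq0 => /eqP ->.
exists u => //; split=> //; exists (y - u) => z dz.
apply: rip_eq_ip => c; have [dcz Tcz] := opZ linT c dz.
by rewrite -Tcz ripC hu'// ripC.
Qed.

(** The domain of T^* T is a core for [T]: a vector of the graph orthogonal to
    the part of the graph above this domain is orthogonal to the range of
    1 + T^* T. *)
Let domTsT_core v : dom T v -> forall e : R, 0 < e ->
  exists x, [/\ domTsT x, nrm (x - v) < e & nrm (T x - T v) < e].
Proof.
move=> dv.
have dsT0 : domTsT 0.
  split; first by case: linT.
  by exists 0 => z dz; rewrite /= op0// !linear0r.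
have [||u [du happ hu]] := @graph_projection _ _ _ hip _ linT clT domTsT _ dsT0 _ v (T v).
- by move=> x [].
- exact: domTsT_lin.
suff -> : v = u by [].
have [x dsx hx] := domTsT_surj (v - u).
have [dvu Tvu] := opB linT dv du.
have := hu x dsx; rewrite -Tvu (ripC _ (T _)) hx// ripBl (ripC _ x) addrCA subrr addr0.
by rewrite rip_sqr// => /eqP; rewrite sqrf_eq0 nrm_eq0 subr_eq0 => /eqP.
Qed.

Lemma nrm_shift_adjoint (z : R[i]) (x t t' : H) :
  nrm t = nrm t' ->
  rip ip t (Num.conj z *: x) = rip ip t' (z *: x) ->
  nrm (t - Num.conj z *: x) = nrm (t' - z *: x).
Proof.
move=> tt' E; apply/eqP; rewrite -(eqrXn2 (ltn0Sn 1)) ?nrm_ge0//.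
rewrite !(nrm_sqrB hip) tt' E !nrmZ.
suff -> : nrm (Num.conj z) = nrm z by [].
by apply: complexI; rewrite -!nrmE norm_conjC.
Qed.

(** With S = T - z this reads |S w|^2 <= |w| |S (S w)|.  For [x] in the core,
    <S w, x> = <w, S^* x> and |S^* x| = |S x|; let [x] tend to S w in the graph
    norm. *)
Lemma normal_shift_sqr (z : R[i]) w : dom T w -> dom T (T w - z *: w) ->
  nrm (T w - z *: w) ^+ 2 <=
    nrm w * nrm (T (T w - z *: w) - z *: (T w - z *: w)).
Proof.
move=> dw; set v := T w - z *: w => dv.
pose C := nrm v + nrm w * (1 + nrm z).
have C0 : 0 <= C by rewrite addr_ge0 ?mulr_ge0 ?addr_ge0 ?nrm_ge0.
apply/ler_addgt0Pr => e e0.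
have d0 : 0 < e / (C + 1) by rewrite divr_gt0 ?ltr_wpDl.
set d := e / (C + 1) in d0.
have [x [dsx xv Txv]] := domTsT_core dv d0.
have [dx dax adjx] := domTsT_adj dsx.
have h1 : nrm v ^+ 2 <= rip ip v x + nrm v * d.
  have -> : nrm v ^+ 2 = rip ip v x + rip ip v (v - x).
    by rewrite ripBr rip_sqr// addrC subrK.
  by rewrite lerD2l (le_trans (rip_le hip _ _))// ler_wpM2l ?nrm_ge0// nrmBC ltW.
have h2 : rip ip v x <= nrm w * nrm (T x - z *: x).
  have -> : rip ip v x = rip ip w (Tadj x - Num.conj z *: x).
    by rewrite ripBl adjoint_rip// ripJ ripBr.
  apply: le_trans (rip_le hip _ _) _; rewrite (nrm_shift_adjoint adjx)//.
  have [dzx Tzx] := opZ linT (Num.conj z) dx.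
  by rewrite ripC -(adjoint_rip dax dzx) Tzx ripJ conjCK.
have h3 : nrm (T x - z *: x) <= nrm (T v - z *: v) + d * (1 + nrm z).
  have -> : T x - z *: x = (T v - z *: v) + ((T x - T v) + z *: (v - x)).
    rewrite [z *: (v - x)]scalerBr.
    move: (T x) (z *: x) (T v) (z *: v) => p q r s.
    by rewrite [RHS]addrA [r - s + _]addrC !subrKA.
  apply: le_trans (nrmD _ _) _; rewrite lerD2l.
  apply: le_trans (nrmD _ _) _; rewrite mulrDr mulr1 lerD//; first exact: ltW.
  by rewrite nrmZ mulrC ler_wpM2r ?nrm_ge0// nrmBC ltW.
have ed : e = d * (C + 1) by rewrite /d divfK// lt0r_neq0// ltr_wpDl.
have h4 := ler_wpM2l (nrm_ge0 w) h3.
move: ed; rewrite /C; have := nrm_ge0 w; lra.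
Qed.

End NormalOperator.

(** * Averaging over roots of unity *)

Section Parseval.
Variables (R : realType) (H : completeNormedModType R[i]).
Variable ip : {dot H for (@Num.conj R[i])}.
Hypothesis hip : inner_product_norm ip.

(** Powers of two suffice as orders: a 2^k-th root of -1 is primitive of order
    2^(k+1). *)
Lemma prim_root_pow2 k : exists w : R[i], (2 ^ k.+1).-primitive_root w.
Proof.
pose w : R[i] := (2 ^ k).-root (-1).
have wk : w ^+ (2 ^ k) = -1 by rewrite rootCK// expn_gt0.
have wk1 : w ^+ (2 ^ k.+1) = 1 by rewrite expnSr exprM wk sqrrN expr1n.
have [|m mw] := prim_order_exists _ wk1; first by rewrite expn_gt0.
move=> /(dvdn_pfactor _ _ (isT : prime 2))[j jk mE]; exists w.
move: jk; rewrite leq_eqVlt => /orP[/eqP jk|]; first by rewrite -jk -mE.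
rewrite ltnS => jk; have : w ^+ (2 ^ k) = 1.
  apply/eqP; rewrite -(prim_order_dvd mw) mE; exact: dvdn_exp2l.
by rewrite wk => /eqP; rewrite eq_sym -addr_eq0 -(natrD _ 1 1) pnatr_eq0.
Qed.

Lemma nrm_root_of_unity n (w : R[i]) : (0 < n)%N -> w ^+ n = 1 -> nrm w = 1.
Proof.
move=> n0 wn; apply/eqP; rewrite -(@eqrXn2 _ n) ?nrm_ge0//.
by rewrite -nrmX wn expr1n -[1]/(1%:C) nrmC normr1.
Qed.

Lemma prim_root_conj n (w : R[i]) : n.-primitive_root w -> w * Num.conj w = 1.
Proof.
move=> pw; rewrite -normCK nrmE (@nrm_root_of_unity n) ?expr1n//.
  exact: prim_order_gt0 pw.
exact: prim_expr_order.
Qed.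

(** Orthogonality of the characters of a cyclic group. *)
Lemma sum_prim_root n (w : R[i]) (k l : 'I_n) : n.-primitive_root w ->
  \sum_(j < n) (w ^+ (j * k) * Num.conj (w ^+ (j * l))) = (k == l)%:R * n%:R.
Proof.
move=> pw; pose z := w ^+ k * Num.conj w ^+ l.
have -> : \sum_(j < n) (w ^+ (j * k) * Num.conj (w ^+ (j * l))) = \sum_(j < n) z ^+ j.
  apply: eq_bigr => j _; rewrite /z exprMn -!exprM ![(j * _)%N]mulnC.
  by rewrite rmorphXn.
have zw : z * w ^+ l = w ^+ k.
  by rewrite /z -mulrA -exprMn [_ * w]mulrC (prim_root_conj pw) expr1n mulr1.
have w1 : w ^+ n = 1 := prim_expr_order pw.
have zn : z ^+ n = 1.
  by rewrite /z exprMn -!exprM mulnC exprM w1 expr1n mul1r mulnC exprM -rmorphXn w1 rmorph1 expr1n.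
have [kl|kl] := eqVneq k l.
  have -> : z = 1.
    by rewrite /z kl -exprMn (prim_root_conj pw) expr1n.
  by under eq_bigr do rewrite expr1n; rewrite sumr_const card_ord mul1r.
rewrite mul0r; apply/eqP; have := subrX1 z n.
rewrite zn subrr => /eqP; rewrite eq_sym mulf_eq0 subr_eq0 => /orP[/eqP z1|//].
move: zw; rewrite z1 mul1r => /eqP; rewrite (eq_prim_root_expr pw) !modn_small//.
by move=> /eqP lk; move: kl; rewrite (ord_inj lk) eqxx.
Qed.

Lemma parseval n (w : R[i]) (c : nat -> H) : n.-primitive_root w ->
  \sum_(j < n) nrm (\sum_(k < n) w ^+ (j * k) *: c k) ^+ 2 =
  n%:R * \sum_(k < n) nrm (c k) ^+ 2.
Proof.
move=> pw; apply: complexI; rewrite rmorphM/= !rmorph_sum/= rmorph_nat.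
transitivity (\sum_(j < n) \sum_(k < n) \sum_(l < n)
    w ^+ (j * k) * Num.conj (w ^+ (j * l)) * ip (c k) (c l)).
  apply: eq_bigr => j _; rewrite rmorphXn/= -nrmE hip linear_sumlz.
  apply: eq_bigr => k _; rewrite linear_sumr; apply: eq_bigr => l _.
  by rewrite linearZl_LR linearZr_LR/= mulrA.
rewrite exchange_big mulr_sumr; apply: eq_bigr => k _ /=.
rewrite exchange_big /= (bigD1 k)//= [X in _ + X]big1 ?addr0.
  by rewrite -mulr_suml sum_prim_root// eqxx mul1r rmorphXn/= -nrmE hip.
by move=> l lk; rewrite -mulr_suml sum_prim_root// eq_sym (negPf lk) !mul0r.
Qed.

End Parseval.

(** * Resolvents of linear operators *)

Section Resolvent.
Variables (R : realType) (H : completeNormedModType R[i]).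
Variable T : operator H.
Hypothesis linT : linear_op T.

(** Membership in the resolvent set without the bound, so that the inverse can be
    named and its norm studied separately. *)
Definition resolvent_at (z : R[i]) (g : H -> H) :=
  (forall y, dom T (g y) /\ T (g y) - z *: g y = y) /\
  (forall x, dom T x -> g (T x - z *: x) = x).

Lemma resolvent_setP z : resolvent_set T z -> exists g, resolvent_at z g /\
  exists2 M : R, 0 < M & forall y, nrm (g y) <= M * nrm y.
Proof.
move=> [g [gr gl [M gM]]]; exists g; split=> //.
exists (Num.max M 1); first by rewrite lt_max ltr01 orbT.
move=> y; have := gM y; rewrite !nrmE -rmorphM lecR => /le_trans; apply.
by rewrite ler_wpM2r ?nrm_ge0// le_max lexx.
Qed.

Lemma resolvent_linear z g : resolvent_at z g ->
  forall c x y, g (c *: x + y) = c *: g x + g y.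
Proof.
move=> [gr gl] c x y; have [dx gx] := gr x; have [dy gy] := gr y.
have [_ /(_ c _ _ dx dy) [d E]] := linT.
rewrite -[RHS]gl// E -{1}gx -{1}gy; congr g.
rewrite scalerBr scalerDr !scalerA [c * z]mulrC opprD addrACA; congr (_ + _).
Qed.

Lemma resolvent_0 z g : resolvent_at z g -> g 0 = 0.
Proof.
move=> /resolvent_linear/(_ (-1) 0 0).
by rewrite scaler0 addr0 scaleN1r addNr.
Qed.

(** Compactness of the circle: at each of its points [T - z] is bounded below, and
    a lower bound at one point gives half of it at all nearby points. *)
Lemma circle_lower_bound z0 (rho : R) :
  (forall z, nrm (z - z0) = rho -> resolvent_set T z) ->
  exists2 c : R, 0 < c & forall z, nrm (z - z0) = rho ->
    forall x, dom T x -> c * nrm x <= nrm (T x - z *: x).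
Proof.
move=> hz.
have [rho0|rho0] := ltP rho 0.
  by exists 1 => // z E; have := nrm_ge0 (z - z0); rewrite E leNgt rho0.
pose e (t : R) : R[i] := Complex (cos t) (sin t).
pose pt t := z0 + rho%:C * e t.
have ne t : nrm (e t) = 1.
  apply/eqP; rewrite -(eqrXn2 (ltn0Sn 1)) ?nrm_ge0//.
  by rewrite nrm_sqr/= cos2Dsin2 expr1n.
have npt t : nrm (pt t - z0) = rho.
  by rewrite /pt addrC addKr nrmM ne mulr1 nrmC ger0_norm.
have ptP z : nrm (z - z0) = rho -> exists2 t, `[- pi, pi]%classic t & z = pt t.
  move=> zrho; have [rho00|rhon0] := eqVneq rho 0.
    exists 0; first by rewrite /= in_itv/= oppr_le0 pi_ge0.
    move: zrho; rewrite rho00 => /eqP; rewrite nrm_eq0 subr_eq0 => /eqP ->.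
    by rewrite /pt rho00 mul0r addr0.
  pose u := (z - z0) / rho%:C.
  have rhoC : rho%:C != 0 by rewrite -[0]/(0%:C) (inj_eq (@complexI R)).
  have nu : nrm u = 1.
    apply: (mulIf rhon0); rewrite mul1r -[in RHS]zrho -{1}[rho]ger0_norm// -nrmC -nrmM.
    by rewrite /u divfK.
  have := nrm_sqr u; rewrite nu expr1n.
  have zu : z = z0 + rho%:C * u by rewrite /u mulrC divfK// addrC subrK.
  clearbody u; case: u nu zu => p q /= nu zu pq.
  have p1 : -1 <= p <= 1.
    rewrite -ler_norml -(ler_pXn2r (ltn0Sn 1)) ?nnegrE// expr1n.
    by rewrite real_normK ?num_real//; have := sqr_ge0 q; lra.
  have sq : Num.sqrt (1 - p ^+ 2) = `|q| by rewrite pq addrC addKr sqrtr_sqr.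
  have [q0|q0] := leP 0 q.
    exists (acos p).
      by rewrite /= in_itv/= acos_lepi// andbT (le_trans _ (acos_ge0 p1))// oppr_le0 pi_ge0.
    by rewrite zu /pt /e acosK ?in_itv// sin_acos// sq ger0_norm.
  exists (- acos p).
    by rewrite /= in_itv/= lerN2 acos_lepi//= (le_trans _ (pi_ge0 R))// oppr_le0 acos_ge0.
  by rewrite zu /pt /e cosN sinN acosK ?in_itv// sin_acos// sq ltr0_norm// opprK.
pose P (c t : R) := forall x, dom T x -> c * nrm x <= nrm (T x - pt t *: x).
have /compact_near_coveringP cpt := @segment_compact R (- pi) pi.
have : \forall c \near 0^'+, `[- pi, pi]%classic `<=` P c.
  apply: (cpt _ _ P _) => t _.
  have [g [[_ gl] [M M0 gM]]] := resolvent_setP (hz _ (npt t)).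
  have Mb : 0 < (4 * M)^-1 by rewrite invr_gt0 mulr_gt0.
  have Mr : 0 < (4 * M)^-1 / (rho + 1) by rewrite divr_gt0// ltr_wpDl.
  have cc : \forall t' \near t, `|cos t - cos t'| < (4 * M)^-1 / (rho + 1).
    by have /cvgrPdist_lt/(_ _ Mr) := @continuous_cos R t.
  have cs : \forall t' \near t, `|sin t - sin t'| < (4 * M)^-1 / (rho + 1).
    by have /cvgrPdist_lt/(_ _ Mr) := @continuous_sin R t.
  (* 1/M bounds T - pt t below; the radius of the neighbourhood of t is chosen
     so that |pt t - pt t'| <= 1/(2M), which still leaves 1/(2M). *)
  near=> t' c => x dx /=.
  have xg : nrm x <= M * nrm (T x - pt t *: x) by rewrite -{1}(gl x dx) gM.
  have ptt : nrm (pt t - pt t') <= 2 * (4 * M)^-1.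
    rewrite /pt opprD addrACA subrr add0r -mulrBr nrmM nrmC ger0_norm//.
    apply: (@le_trans _ _ (rho * (2 * ((4 * M)^-1 / (rho + 1))))).
      rewrite ler_wpM2l// (le_trans (nrm_le_ReIm _))//= mulr2n mulrDl mul1r lerD// ltW//.
        by near: t'.
      by near: t'.
    rewrite mulrCA ler_pM2l// mulrCA; apply: ler_piMr; first exact: ltW.
    rewrite ler_pdivrMr ?ltr_wpDl//.
    by rewrite mul1r lerDl.
  have tri : nrm (T x - pt t *: x) <=
      nrm (T x - pt t' *: x) + 2 * (4 * M)^-1 * nrm x.
    apply: le_trans (nrm_triB (pt t' *: x) _ _) _.
    by rewrite lerD2l -scalerBl nrmZ nrmBC ler_wpM2r ?nrm_ge0.
  have cL : c < (4 * M)^-1 by near: c; exact: nbhs_right_lt.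
  have LM : (4 * M)^-1 * M = 4^-1 by field; exact: lt0r_neq0.
  have := ler_wpM2l (ltW M0) tri; have := ler_wpM2r (nrm_ge0 x) (ltW cL).
  move: LM xg; set L := (4 * M)^-1; set n := nrm x; set A := nrm (T x - pt t' *: x).
  have n0 : 0 <= n := nrm_ge0 x.
  move=> LM xg cLn; rewrite mulrDr => xA.
  apply: le_trans cLn _; rewrite -(ler_pM2l M0) mulrA [M * L]mulrC LM.
  have : M * (2 * L * n) = 2^-1 * n.
    have -> : M * (2 * L * n) = 2 * (L * M) * n by ring.
    by rewrite LM; field.
  by move: xg xA; lra.
move=> hP.
have [c [c0 cP]] := filter_ex (filterI (nbhs_right_gt (0 : R)) hP).
exists c => // z /ptP[t tpi ->]; exact: cP.
Unshelve. all: by end_near.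
Qed.

End Resolvent.

(** * The resolvent of a normal operator *)

Section NormalResolvent.
Variables (R : realType) (H : completeNormedModType R[i]).
Variable ip : {dot H for (@Num.conj R[i])}.
Hypothesis hip : inner_product_norm ip.
Variable T : operator H.
Hypothesis normT : normal_op ip T.

Let linT : linear_op T. Proof. by case: normT. Qed.

Lemma bernoulli_ineq (d : R) n : 0 <= d <= 1 -> 1 - n%:R * d <= (1 - d) ^+ n.
Proof.
move=> /andP[d0 d1]; elim: n => [|n IH]; first by rewrite mul0r subr0 expr0.
have h : 0 <= 1 - d by rewrite subr_ge0.
rewrite exprS; apply: le_trans (ler_wpM2l h IH).
have : 0 <= n%:R * d ^+ 2 by rewrite mulr_ge0 ?sqr_ge0.
by rewrite -natr1; lra.
Qed.

(** [normal_shift_sqr] says that the quotients |g^(k+1) y| / |g^k y| increase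
    with k. *)
Lemma resolvent_iter_ratio z g (t : R) y : resolvent_at T z g -> 0 <= t ->
  t * nrm y <= nrm (g y) -> forall k, t ^+ k * nrm y <= nrm (iter k g y).
Proof.
move=> rg t0 ty.
have g0 := resolvent_0 linT rg.
suff h k : t * nrm (iter k g y) <= nrm (iter k.+1 g y).
  elim=> [|k IH]; first by rewrite expr0 mul1r.
  by rewrite exprS -mulrA (le_trans (ler_wpM2l t0 IH)).
elim: k => [//|k IH]; rewrite /=.
set u := iter k g y in IH *; rewrite /= -/u in IH.
have [dgu gu] := rg.1 u; have [dggu ggu] := rg.1 (g u).
have [->|u0] := eqVneq u 0; first by rewrite !g0 nrm0 mulr0.
have un : 0 < nrm u by rewrite lt_neqAle eq_sym nrm_eq0 u0 nrm_ge0.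
have := normal_shift_sqr hip normT (z := z) dggu; rewrite ggu gu => /(_ dgu) hsq.
rewrite -(ler_pM2r un); apply: le_trans hsq; rewrite expr2 -mulrA mulrCA.
by apply: ler_wpM2l; first exact: nrm_ge0.
Qed.

(** Telescoping: (T - z0 - a) a^k g^(k+1) y = a^k g^k y - a^(k+1) g^(k+1) y. *)
Lemma resolvent_geometric_sum z0 g (a : R[i]) y m : resolvent_at T z0 g ->
  let u := \sum_(k < m) a ^+ k *: iter k.+1 g y in
  dom T u /\ T u - (z0 + a) *: u = y - a ^+ m *: iter m g y.
Proof.
move=> rg; elim: m => [|m IH] /=.
  rewrite big_ord0 (op0 linT) scaler0 subr0 expr0 scale1r subrr.
  by split=> //; case: linT.
rewrite big_ord_recr/=; case: IH; set u := \sum_(k < m) _ => du Tu.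
have [dg gE] := rg.1 (iter m g y).
have [dag Tag] := opZ linT (a ^+ m) dg.
have [dua Tua] := opD linT du dag; split=> //.
rewrite Tua scalerDr opprD addrACA Tu Tag scalerA [_ * a ^+ m]mulrC -scalerA -scalerBr.
rewrite scalerDl opprD addrA gE scalerBr addrA subrK scalerA -exprSr//.
Qed.

(** The hypotheses on [s] say that it is the norm of [g].  Were the circle of
    radius 1/s about [z0] free of spectrum, [bound] would hold for all powers of
    two: for a vector [y] of norm 1 its left-hand side is a lower estimate, and
    its right-hand side an upper estimate, of the mean square of the geometric
    sums of [resolvent_geometric_sum] over the roots of unity. *)
Lemma normal_circle_meets_spectrum z0 g (s : R) : resolvent_at T z0 g -> 0 < s ->
  (forall y, nrm (g y) <= s * nrm y) ->
  (forall t, t < s -> exists2 y, 0 < nrm y & t * nrm y <= nrm (g y)) ->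
  ~ (forall z, nrm (z - z0) = s^-1 -> resolvent_set T z).
Proof.
move=> rg s0 gs gt hz.
have [c c0 hc] := circle_lower_bound hz.
have bound k : (2 ^ k.+1)%:R * (s ^+ 2 / 2) <= 4 / c ^+ 2.
  have [w pw] := prim_root_pow2 R k; set n := (2 ^ k.+1)%N in pw *.
  have n0 : (0 < n)%N by rewrite expn_gt0.
  (* By Bernoulli's inequality (1 - d)^n >= 3/4, so n iterations of g, each
     losing at most a factor 1 - d, together lose a bounded factor. *)
  pose d : R := (4 * n%:R)^-1.
  have nR : 0 < n%:R :> R by rewrite ltr0n.
  have d0 : 0 < d by rewrite invr_gt0 mulr_gt0.
  have d1 : d <= 1.
    by rewrite invf_le1 ?mulr_gt0// -natrM ler1n muln_gt0.
  have nd : n%:R * d = 4^-1 by rewrite /d; field; exact: lt0r_neq0.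
  have sd : s * (1 - d) < s by rewrite gtr_pMr// ltrBlDr ltrDl.
  have [y y0 gy] := gt _ sd.
  have d1' : 0 <= 1 - d by rewrite subr_ge0.
  have low := resolvent_iter_ratio rg (mulr_ge0 (ltW s0) d1') gy.
  have up : nrm (iter n g y) <= s ^+ n * nrm y.
    suff h m : nrm (iter m g y) <= s ^+ m * nrm y by exact: h.
    elim: m => [|m IH]; first by rewrite expr0 mul1r.
    by rewrite iterS (le_trans (gs _))// exprS -mulrA ler_wpM2l// ltW.
  have wn : w ^+ n = 1 := prim_expr_order pw.
  pose cc m := (s^-1)%:C ^+ m *: iter m.+1 g y.
  have circ (j : 'I_n) :
      nrm (\sum_(m < n) w ^+ (j * m) *: cc m) ^+ 2 <= (4 / c ^+ 2) * nrm y ^+ 2.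
    pose a := (s^-1)%:C * w ^+ j.
    have an : nrm a = s^-1.
      rewrite nrmM nrmC ger0_norm ?invr_ge0 ?ltW// nrmX.
      by rewrite (nrm_root_of_unity n0 wn) expr1n mulr1.
    have -> : \sum_(m < n) w ^+ (j * m) *: cc m = \sum_(m < n) a ^+ m *: iter m.+1 g y.
      by apply: eq_bigr => m _; rewrite /cc scalerA exprMn -exprM mulrC.
    have [du Tu] := resolvent_geometric_sum a y n rg.
    have := hc (z0 + a); rewrite addrC addKr => /(_ an _ du).
    rewrite Tu; set u := \sum_(m < n) _ => cu.
    have : c * nrm u <= 2 * nrm y.
      apply: le_trans cu _; apply: le_trans (nrmB _ _) _.
      rewrite mulr2n mulrDl mul1r lerD2l nrmZ nrmX an exprVn.
      by rewrite ler_pdivrMl ?exprn_gt0.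
    have c0' := ltW c0.
    rewrite -(ler_pXn2r (ltn0Sn 1)) ?nnegrE ?mulr_ge0 ?nrm_ge0// !exprMn => h.
    rewrite -(ler_pM2l (exprn_gt0 2 c0)); apply: le_trans h _.
    have -> : c ^+ 2 * (4 / c ^+ 2 * nrm y ^+ 2) = 4 * nrm y ^+ 2.
      by field; exact: lt0r_neq0.
    by rewrite -natrX.
  have cclow (m : 'I_n) : s ^+ 2 / 2 * nrm y ^+ 2 <= nrm (cc m) ^+ 2.
    have s0' := ltW s0.
    rewrite /cc nrmZ nrmX nrmC ger0_norm ?invr_ge0//.
    have h1 : s * (1 - d) ^+ m.+1 * nrm y <= s^-1 ^+ m * nrm (iter m.+1 g y).
      rewrite exprVn ler_pdivlMl ?exprn_gt0//.
      have <- : (s * (1 - d)) ^+ m.+1 * nrm y = s ^+ m * (s * (1 - d) ^+ m.+1 * nrm y).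
        by rewrite exprMn [s ^+ m.+1]exprSr; ring.
      exact: low.
    have h2 : 3 / 4 <= (1 - d) ^+ m.+1.
      have dn : (1 - d) ^+ n <= (1 - d) ^+ m.+1.
        by apply: ler_wiXn2l => //; rewrite gerBl ltW.
      apply: le_trans dn; have := @bernoulli_ineq d n; rewrite nd ltW// d1 => /(_ isT).
      by apply: le_trans; lra.
    move: h1 h2; move: ((1 - d) ^+ m.+1) (s^-1 ^+ m * _) => v p h1 h2.
    have v0 : 0 <= v by rewrite (le_trans _ h2)// divr_ge0.
    apply: (@le_trans _ _ ((s * v * nrm y) ^+ 2)).
      rewrite !exprMn ler_pM2r ?exprn_gt0// ler_pM2l ?exprn_gt0//.
      apply: (@le_trans _ _ ((3 / 4) ^+ 2)); first by lra.
      by rewrite ler_pXn2r// nnegrE// divr_ge0.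
    have svy : 0 <= s * v * nrm y by rewrite !mulr_ge0 ?nrm_ge0// ltW.
    by rewrite ler_pXn2r// nnegrE (le_trans svy).
  have := parseval hip cc pw.
  have : \sum_(j < n) nrm (\sum_(m < n) w ^+ (j * m) *: cc m) ^+ 2 <=
      \sum_(j < n) (4 / c ^+ 2) * nrm y ^+ 2 by apply: ler_sum => j _; exact: circ.
  move=> /[swap] ->; rewrite sumr_const card_ord -[leRHS]mulr_natl ler_pM2l//.
  move=> h; rewrite -(ler_pM2r (exprn_gt0 2 y0)); apply: le_trans h.
  have : \sum_(m < n) s ^+ 2 / 2 * nrm y ^+ 2 <= \sum_(m < n) nrm (cc m) ^+ 2.
    by apply: ler_sum => m _; exact: cclow.
  by apply: le_trans; rewrite sumr_const card_ord -mulrnAl mulr_natl.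
have s2 : 0 < s ^+ 2 / 2 by rewrite divr_gt0 ?exprn_gt0.
pose k := Num.truncn (4 / c ^+ 2 / (s ^+ 2 / 2)).
have := bound k; rewrite -ler_pdivlMr// leNgt => /negP; apply.
apply: lt_trans (truncnS_gt _) _; rewrite ltr_nat.
by rewrite (leq_ltn_trans _ (ltn_expl _ (ltnSn 1))).
Qed.

(** The norm [s] of the resolvent at [z0] satisfies r s <= 1, since otherwise the
    circle of radius 1/s would lie inside the disc of radius [r], contrary to
    [normal_circle_meets_spectrum]. *)
Lemma normal_resolvent_bound z0 (r : R) :
  (forall z, nrm (z - z0) <= r -> resolvent_set T z) ->
  0 <= r -> forall x, dom T x -> r * nrm x <= nrm (T x - z0 *: x).
Proof.
move=> hz r0.
have [g [rg [M M0 gM]]] : exists g, resolvent_at T z0 g /\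
    exists2 M : R, 0 < M & forall y, nrm (g y) <= M * nrm y.
  by apply: resolvent_setP; apply: hz; rewrite subrr nrm0.
have glin := resolvent_linear linT rg.
pose E := [set nrm (g y) | y in [set y | nrm y <= 1]].
have g0 := resolvent_0 linT rg.
have gZ (c : R[i]) y : g (c *: y) = c *: g y.
  by rewrite -[c *: y]addr0 glin g0 addr0.
have E0 : E !=set0 by exists 0; exists 0; rewrite /= ?g0 ?nrm0.
have Eub : has_ubound E.
  by exists M => _ [y /= y1 <-]; rewrite (le_trans (gM y))// ler_piMr// ltW.
pose s := sup E.
have gs y : nrm (g y) <= s * nrm y.
  have [->|y0] := eqVneq y 0; first by rewrite g0 !nrm0 mulr0.
  have yn : 0 < nrm y by rewrite lt_neqAle eq_sym nrm_eq0 y0 nrm_ge0.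
  have ny : nrm ((nrm y)^-1)%:C = (nrm y)^-1 by rewrite nrmC ger0_norm ?invr_ge0 ?ltW.
  rewrite -ler_pdivrMr// mulrC; apply: ub_le_sup => //.
  exists (((nrm y)^-1)%:C *: y); last by rewrite gZ nrmZ ny.
  by rewrite /= nrmZ ny mulVf// lt0r_neq0.
have s0 : 0 <= s by apply: ub_le_sup => //; exists 0; rewrite /= ?g0 ?nrm0.
have rs : r * s <= 1.
  rewrite leNgt; apply/negP => rs1.
  have sp : 0 < s.
    by rewrite lt_neqAle s0 andbT; apply: contraTneq rs1 => <-; rewrite mulr0 ltr10.
  apply: (normal_circle_meets_spectrum rg sp gs).
    move=> t ts; have [t0|t0] := ltP t 0.
      have := sp; rewrite -[s]/(sup E) => /(sup_gt E0)[_ [y /= y1 <-] gy].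
      exists y.
        rewrite lt_neqAle nrm_ge0 andbT eq_sym nrm_eq0; apply: contraTneq gy => ->.
        by rewrite g0 nrm0 ltxx.
      by rewrite (le_trans _ (nrm_ge0 _))// nmulr_rle0 ?nrm_ge0.
    have [_ [y /= y1 <-] gy] := sup_gt E0 ts.
    exists y; last by rewrite (le_trans _ (ltW gy))// ler_piMr.
    rewrite lt_neqAle nrm_ge0 andbT eq_sym nrm_eq0; apply: contraTneq gy => ->.
    by rewrite g0 nrm0 -leNgt.
  move=> z zs; apply: hz; rewrite zs -[leLHS]mul1r ler_pdivrMr//; exact: ltW.
move=> x dx; have := gs (T x - z0 *: x); rewrite (rg.2 _ dx) => xs.
apply: le_trans (ler_wpM2l r0 xs) _; rewrite mulrA ler_piMl// nrm_ge0//.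
Qed.

End NormalResolvent.

(** * Relatively bounded perturbations *)

Section Perturbation.
Variables (R : realType) (H : completeNormedModType R[i]).

(** The iteration u |-> y - B u started at 0. *)
Lemma contraction_solve (B : H -> H) (q : R) : 0 <= q < 1 ->
  (forall u v, nrm (B u - B v) <= q * nrm (u - v)) ->
  forall y, exists u, u + B u = y.
Proof.
move=> /andP[q0 q1] hB y.
have p0 : 0 < 1 - q by rewrite subr_gt0.
pose u k := iter k (fun v => y - B v) 0.
have uS k : u k.+1 = y - B (u k) by [].
pose C := nrm (u 1%N - u 0%N) / (1 - q).
have C0 : 0 <= C by rewrite divr_ge0 ?nrm_ge0 ?ltW.
have CE : nrm (u 1%N - u 0%N) = C * (1 - q) by rewrite /C divfK ?lt0r_neq0.
have step m n : nrm (u m.+1 - u n.+1) <= q * nrm (u m - u n).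
  have -> : u m.+1 - u n.+1 = B (u n) - B (u m).
    by rewrite !uS opprB [B (u n) - y]addrC addrACA subrr add0r addrC.
  by rewrite (le_trans (hB _ _))// nrmBC.
have base k : nrm (u k - u 0%N) <= C.
  elim: k => [|k IH]; first by rewrite subrr nrm0.
  apply: le_trans (nrm_triB (u 1%N) _ _) _; rewrite CE.
  by have := step k 0%N; have := ler_wpM2l q0 IH; lra.
have dec n k : nrm (u (n + k)%N - u n) <= q ^+ n * C.
  elim: n => [|n IH]; first by rewrite expr0 mul1r.
  by rewrite addSn (le_trans (step _ _))// exprS -mulrA ler_wpM2l.
have small (e : R) : 0 < e -> exists N, q ^+ N * C < e.
  move=> e0; have /cvgrPdist_lt/(_ (e / (C + 1))) : (GRing.exp q) @ \oo --> (0 : R).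
    by apply: cvg_expr; rewrite ger0_norm.
  rewrite divr_gt0 ?ltr_wpDl// => /(_ isT)[N _ /(_ N (leqnn N))] /=.
  rewrite sub0r normrN ger0_norm ?exprn_ge0// ltr_pdivlMr ?ltr_wpDl// => h.
  exists N; apply: le_lt_trans h; rewrite ler_wpM2l ?exprn_ge0// lerDl//.
have [l hl] : exists l, forall e : R, 0 < e -> exists N, forall n, (N <= n)%N ->
    nrm (u n - l) < e.
  apply: cauchy_limit => e e0.
  have [|N hN] := small (e / 2); first by rewrite divr_gt0.
  exists N => m n /subnKC <- /subnKC <-.
  apply: le_lt_trans (nrm_triB (u N) _ _) _; rewrite (nrmBC (u N)).
  by have := dec N (m - N)%N; have := dec N (n - N)%N; lra.
exists l; apply/eqP; rewrite -subr_eq0 -nrm_eq0 eq_le nrm_ge0 andbT.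
apply/ler_addgt0Pr => e e0; rewrite add0r.
have [|N hN] := hl (e / 2); first by rewrite divr_gt0.
have -> : l + B l - y = (l - u N.+1) + (B l - B (u N)).
  by rewrite uS opprB -[RHS]addrA [B (u N) - y + _]addrC subrKA addrA.
have h1 := hN N (leqnn N); have h2 := hN N.+1 (leqnSn N).
apply: le_trans (nrmD _ _) _; rewrite (nrmBC l).
have := hB l (u N); rewrite (nrmBC l).
have : q * nrm (u N - l) <= nrm (u N - l) by rewrite ler_piMl ?nrm_ge0// ltW.
lra.
Qed.

(** Factor T + A - z = (1 + A g) (T - z) with g the resolvent of [T] at [z]; the
    operator A g is Lipschitz with constant [q] < 1. *)
Lemma resolvent_perturb (T A : operator H) (z : R[i]) (q : R) :
  linear_op T -> linear_op A -> dom T `<=` dom A -> 0 <= q < 1 ->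
  resolvent_set T z ->
  (forall x, dom T x -> nrm (A x) <= q * nrm (T x - z *: x)) ->
  resolvent_set (add_op T A) z.
Proof.
move=> linT linA TA /[dup] q01 /andP[q0 q1] /resolvent_setP[g [rg [M M0 gM]]] hq.
have p0 : 0 < 1 - q by rewrite subr_gt0.
have dg y := (rg.1 y).1.
have hB u v : nrm (A (g u) - A (g v)) <= q * nrm (u - v).
  have [d E] := opB linT (dg u) (dg v); have [_ EA] := opB linA (TA _ (dg u)) (TA _ (dg v)).
  rewrite -EA (le_trans (hq _ d))// E scalerBr opprD addrACA -opprD.
  by rewrite (rg.1 u).2 (rg.1 v).2.
have uniq u v : u + A (g u) = v + A (g v) -> u = v.
  move=> /eqP; rewrite -subr_eq0 opprD addrACA addr_eq0 => /eqP E.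
  have := hB u v; rewrite -nrmN -E => h.
  apply/eqP; rewrite -subr_eq0 -nrm_eq0 eq_le nrm_ge0 andbT.
  by rewrite -(pmulr_rle0 _ p0) mulrBl mul1r subr_le0.
have /choice[f hf] := contraction_solve q01 hB.
exists (fun y => g (f y)); split=> /=.
- move=> y; split; first exact: dg.
  by rewrite addrAC (rg.1 _).2 hf.
- move=> x dx; rewrite -[RHS](rg.2 _ dx); congr g; apply: uniq.
  by rewrite hf (rg.2 _ dx) addrAC.
exists (M / (1 - q)) => y; rewrite !nrmE -rmorphM lecR.
apply: le_trans (gM _) _; rewrite -mulrA ler_pM2l// ler_pdivlMl//.
have A0 : A (g 0) = 0 by rewrite (resolvent_0 linT rg) (op0 linA).
have := hB (f y) 0; rewrite A0 !subr0.
have : nrm (f y) <= nrm y + nrm (A (g (f y))).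
  by rewrite -{1}[f y](addrK (A (g (f y)))) hf nrmB.
lra.
Qed.

End Perturbation.

Section GapStrip.
Variables (R : realType) (H : completeNormedModType R[i]).
Variable ip : {dot H for (@Num.conj R[i])}.
Hypothesis hip : inner_product_norm ip.
Variables (T A : operator H).
Hypotheses (normT : normal_op ip T) (linA : linear_op A) (TA : dom T `<=` dom A).
Variables (a b : R).
Hypothesis hTA : forall x : H, dom T x ->
  `|A x| ^+ 2 <= (a ^+ 2)%:C * `|x| ^+ 2 + (b ^+ 2)%:C * `|T x| ^+ 2.

(** With q = (k b)^2, p = 1 - q and z' = z / p,
    |l - z|^2 - k^2 (a^2 + b^2 |l|^2) = p (|l - z'|^2 - r2),
    and the same identity holds with |(T - z) x|, |x| and |T x| in place of
    |l - z|, 1 and |l|.  So the hypothesis on the spectrum says that the closed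
    disc of radius sqrt r2 about z' avoids it, and [normal_resolvent_bound] at
    z' yields k |A x| <= |(T - z) x|. *)
Lemma relbound_resolvent (k : R) (z : R[i]) :
  1 < k -> 0 <= b -> k * b < 1 -> resolvent_set T z ->
  (forall l, spectrum T l ->
     k ^+ 2 * (a ^+ 2 + b ^+ 2 * nrm l ^+ 2) < nrm (l - z) ^+ 2) ->
  resolvent_set (add_op T A) z.
Proof.
move=> k1 b0 kb1 zT hsp.
have k0 : 0 < k := lt_trans ltr01 k1.
have linT : linear_op T by case: normT.
pose q := (k * b) ^+ 2; pose p := 1 - q.
have q0 : 0 <= q by rewrite sqr_ge0.
have p0 : 0 < p by rewrite subr_gt0 expr_lt1// mulr_ge0// ltW.
pose z' := (p^-1)%:C * z.
pose r2 := (k ^+ 2 * a ^+ 2 + nrm z ^+ 2 * q / p) / p.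
have r20 : 0 <= r2.
  have p0' := ltW p0.
  by rewrite /r2 divr_ge0// addr_ge0// ?divr_ge0// mulr_ge0 ?sqr_ge0.
have zz' : complex.Re z' = complex.Re z / p /\ complex.Im z' = complex.Im z / p.
  by rewrite /z'; case: (z) => x y /=; rewrite !mul0r subr0 addr0 !(mulrC _ p^-1).
apply: (@resolvent_perturb _ _ T A z k^-1) => //.
  by rewrite invr_ge0 ltW//= invf_lt1.
move=> x dx.
have rT : Num.sqrt r2 * nrm x <= nrm (T x - z' *: x).
  apply: (normal_resolvent_bound hip normT _ (sqrtr_ge0 _) dx) => l hl.
  apply: contrapT => lsp; have := hsp l lsp.
  have : nrm (l - z') ^+ 2 <= r2.
    by rewrite -[leRHS]sqr_sqrtr// ler_pXn2r ?nnegrE ?nrm_ge0 ?sqrtr_ge0.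
  rewrite /r2 ler_pdivlMr// !nrm_sqr !raddfB/= zz'.1 zz'.2.
  move: (complex.Re z) (complex.Im z) (complex.Re l) (complex.Im l) => x1 y1 s t.
  have E : ((s - x1 / p) ^+ 2 + (t - y1 / p) ^+ 2) * p =
      (s - x1) ^+ 2 + (t - y1) ^+ 2 - q * (s ^+ 2 + t ^+ 2) +
      (x1 ^+ 2 + y1 ^+ 2) * q / p.
    have qp : q = 1 - p by rewrite /p; ring.
    by rewrite qp; field; exact: lt0r_neq0.
  rewrite E lerD2r /q exprMn; lra.
have rT2 : r2 * nrm x ^+ 2 <= nrm (T x - z' *: x) ^+ 2.
  rewrite -[r2]sqr_sqrtr// -exprMn ler_pXn2r// nnegrE ?nrm_ge0//.
  by rewrite mulr_ge0 ?sqrtr_ge0 ?nrm_ge0.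
have hA : nrm (A x) ^+ 2 <= a ^+ 2 * nrm x ^+ 2 + b ^+ 2 * nrm (T x) ^+ 2.
  have := hTA dx; rewrite !nrmE -!rmorphXn -!rmorphM -rmorphD lecR//.
have main : k ^+ 2 * (a ^+ 2 * nrm x ^+ 2 + b ^+ 2 * nrm (T x) ^+ 2) <=
    nrm (T x - z *: x) ^+ 2.
  have p0' := ltW p0.
  move: rT2; rewrite !(nrm_sqrB hip) /z' -scalerA ripZr !nrmZ nrmC ger0_norm ?invr_ge0//.
  rewrite -(ler_pM2r p0) /r2.
  move: (rip ip _ _) (nrm (T x)) (nrm x) (nrm z) => o t u v.
  have -> : (k ^+ 2 * a ^+ 2 + v ^+ 2 * q / p) / p * u ^+ 2 * p =
    k ^+ 2 * a ^+ 2 * u ^+ 2 + (v ^+ 2 * u ^+ 2) * (q / p) by field; exact: lt0r_neq0.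
  have -> : (t ^+ 2 - 2 * (p^-1 * o) + (p^-1 * (v * u)) ^+ 2) * p =
     (1 - q) * t ^+ 2 - 2 * o + (v * u) ^+ 2 + (v ^+ 2 * u ^+ 2) * (q / p).
    have qp : q = 1 - p by rewrite /p; ring.
    by rewrite qp; field; exact: lt0r_neq0.
  rewrite lerD2r /q exprMn; lra.
rewrite ler_pdivlMl//.
have k0' := ltW k0.
rewrite -(ler_pXn2r (ltn0Sn 1)) ?nnegrE ?mulr_ge0 ?nrm_ge0// exprMn.
by apply: le_trans main; rewrite ler_pM2l// exprn_gt0.
Qed.

End GapStrip.

(** * Gaps: the real inequalities *)

Section GapArithmetic.
Variables (R : realType) (K b : R).
Hypotheses (K0 : 0 <= K) (b01 : 0 <= b < 1).

Let f (m : R) := Num.sqrt (K + b ^+ 2 * m ^+ 2).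

Let rad_ge0 m : 0 <= K + b ^+ 2 * m ^+ 2.
Proof. by rewrite addr_ge0// mulr_ge0 ?sqr_ge0. Qed.

Let f_sqr m : f m ^+ 2 = K + b ^+ 2 * m ^+ 2.
Proof. by rewrite sqr_sqrtr. Qed.

Lemma sqrt_rad_ge m : b * `|m| <= f m.
Proof.
have /andP[b0 _] := b01.
rewrite -(ler_pXn2r (ltn0Sn 1)) ?nnegrE ?mulr_ge0 ?sqrtr_ge0// f_sqr exprMn.
by rewrite real_normK ?num_real// lerDr.
Qed.

Lemma sqrt_rad_lipschitz m m' : f m' <= f m + b * `|m' - m|.
Proof.
have /andP[b0 _] := b01.
rewrite -(ler_pXn2r (ltn0Sn 1)) ?nnegrE ?addr_ge0 ?mulr_ge0 ?sqrtr_ge0//.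
rewrite sqrrD !f_sqr exprMn real_normK ?num_real//.
have h := ler_wpM2r (mulr_ge0 b0 (normr_ge0 (m' - m))) (sqrt_rad_ge m).
have : b ^+ 2 * (m * (m' - m)) <= b * `|m| * (b * `|m' - m|).
  rewrite [leRHS](_ : _ = b ^+ 2 * (`|m| * `|m' - m|)); last by ring.
  by rewrite ler_wpM2l ?sqr_ge0// -normrM ler_norm.
by move: h; rewrite mulr2n; lra.
Qed.

(** Because [f] is b-Lipschitz with b < 1, the strict inequalities at the end
    points [s] and [t] propagate to all [m] outside the gap, and there is room
    for a factor k > 1. *)
Lemma gap_margin (s t x : R) : s + f s < x -> x < t - f t ->
  exists k : R, [/\ 1 < k, k * b < 1 & forall m, m <= s \/ t <= m ->
    k ^+ 2 * (K + b ^+ 2 * m ^+ 2) < (x - m) ^+ 2].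
Proof.
have /andP[b0 b1] := b01.
move=> sx xt; have fs0 : 0 <= f s := sqrtr_ge0 _; have ft0 : 0 <= f t := sqrtr_ge0 _.
(* d is the slack in the three strict inequalities, and k = 1 + e with e small
   enough to use up at most this slack in each of them. *)
pose d := Num.min (x - s - f s) (Num.min (t - x - f t) (1 - b)).
have d0 : 0 < d by rewrite !lt_min; apply/and3P; split; lra.
have d1 : d <= x - s - f s by rewrite /d ge_min lexx.
have d2 : d <= t - x - f t by rewrite /d !ge_min lexx orbT.
have d3 : d <= 1 - b by rewrite /d !ge_min lexx !orbT.
pose S := 1 + f s + f t + b; have S0 : 0 < S by rewrite /S; lra.
pose e := d / S.
have e0 : 0 < e by rewrite divr_gt0.
have eS : e + e * f s + e * f t + e * b = d.
  by rewrite -[d](divfK (lt0r_neq0 S0)) -/e /S; ring.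
have es : 0 <= e * f s by rewrite mulr_ge0// ltW.
have et : 0 <= e * f t by rewrite mulr_ge0// ltW.
have eb : 0 <= e * b by rewrite mulr_ge0// ltW.
exists (1 + e); split; [lra|lra|].
move=> m hm.
have k0 : 0 <= 1 + e by lra.
have kb : (1 + e) * b <= 1 by lra.
rewrite -f_sqr -exprMn -[ltRHS](real_normK (num_real _)).
rewrite ltr_pXn2r ?nnegrE ?mulr_ge0 ?sqrtr_ge0//.
case: hm => hm.
  have nm : `|m - s| = s - m by rewrite distrC ger0_norm ?subr_ge0.
  have := ler_wpM2l k0 (sqrt_rad_lipschitz s m); rewrite nm.
  have := ler_wpM2r (_ : 0 <= s - m) kb; rewrite subr_ge0 => /(_ hm).
  have := ler_norm (x - m); lra.
have nm : `|m - t| = m - t by rewrite ger0_norm ?subr_ge0.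
have := ler_wpM2l k0 (sqrt_rad_lipschitz t m); rewrite nm.
have := ler_wpM2r (_ : 0 <= m - t) kb; rewrite subr_ge0 => /(_ hm).
have := ler_norm (m - x); rewrite distrC; lra.
Qed.

End GapArithmetic.

(** * Limits superior and inferior of real sequences *)

Section LimSupInf.
Variable R : realType.
Implicit Types (u : nat -> R) (l : R).

Let ereal_between_gt (y : \bar R) l : (l%:E < y)%E -> exists2 l', l < l' & (l'%:E < y)%E.
Proof.
case: y => [y| |//]; last by exists (l + 1); rewrite ?ltry// ltrDl.
by rewrite lte_fin => ly; exists ((l + y) / 2); rewrite ?lte_fin; lra.
Qed.

Let ereal_between_lt (y : \bar R) l : (y < l%:E)%E -> exists2 l', l' < l & (y < l'%:E)%E.
Proof.
move=> yl; have [|l' ll' hl'] := @ereal_between_gt (- y)%E (- l).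
  by rewrite EFinN lteN2.
by exists (- l'); [lra|rewrite EFinN lteNr].
Qed.

Lemma limn_esup_gtP u l : (l%:E < limn_esup (fun n => (u n)%:E))%E <->
  exists2 l', l < l' & forall N, exists2 n, (N <= n)%N & l' < u n.
Proof.
split=> [/ereal_between_gt[l' ll' hl']|[l' ll' hl']].
  exists l' => // N; have := hl'; rewrite /limn_esup /limf_esup => h.
  have : (l'%:E < ereal_sup ((fun n => (u n)%:E) @` [set n | (N <= n)%N]))%E.
    apply: lt_le_trans h _; apply: ereal_inf_lbound.
    by exists [set n | (N <= n)%N] => //; exists N.
  by move=> /ereal_sup_gt[_ [n /= Nn <-]]; rewrite lte_fin => ?; exists n.
apply: (@lt_le_trans _ _ l'%:E); first by rewrite lte_fin.
apply: le_ereal_inf_tmp => _ [V [N _ NV] <-].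
have [n Nn ln] := hl' N.
apply: (@le_trans _ _ (u n)%:E); first by rewrite lee_fin ltW.
by apply: ereal_sup_ubound; exists n => //; exact: NV.
Qed.

Lemma limn_esup_ltP u l : (limn_esup (fun n => (u n)%:E) < l%:E)%E <->
  exists2 l', l' < l & exists N, forall n, (N <= n)%N -> u n < l'.
Proof.
split=> [/ereal_inf_lt[_ [V [N _ NV] <-]] /ereal_between_lt[l' ll' hl']|[l' ll' [N hN]]].
  exists l' => //; exists N => n Nn; rewrite -lte_fin; apply: le_lt_trans hl'.
  by apply: ereal_sup_ubound; exists n => //; exact: NV.
apply: (@le_lt_trans _ _ l'%:E); last by rewrite lte_fin.
apply: (@le_trans _ _ (ereal_sup ((fun n => (u n)%:E) @` [set n | (N <= n)%N]))).
  apply: ereal_inf_lbound.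
  by exists [set n | (N <= n)%N] => //; exists N.
by apply: ge_ereal_sup => _ [n /= Nn <-]; rewrite lee_fin ltW// hN.
Qed.

Let limn_einfE u : limn_einf (fun n => (u n)%:E) =
  (- limn_esup (fun n => ((- u n))%:E))%E.
Proof. by []. Qed.

Lemma limn_einf_ltP u l : (limn_einf (fun n => (u n)%:E) < l%:E)%E <->
  exists2 l', l' < l & forall N, exists2 n, (N <= n)%N & u n < l'.
Proof.
rewrite limn_einfE lteNl -EFinN (limn_esup_gtP (fun n => - u n) (- l)).
by split=> -[l' ll' hl']; (exists (- l'); first lra);
  move=> N; have [n Nn ln] := hl' N; exists n => //; lra.
Qed.

Lemma limn_einf_gtP u l : (l%:E < limn_einf (fun n => (u n)%:E))%E <->
  exists2 l', l < l' & exists N, forall n, (N <= n)%N -> l' < u n.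
Proof.
rewrite limn_einfE lteNr -EFinN (limn_esup_ltP (fun n => - u n) (- l)).
by split=> -[l' ll' [N hN]]; (exists (- l'); first lra);
  exists N => n /hN; lra.
Qed.

End LimSupInf.

(** * Asymptotics of the gap ratios *)

Section GapRatio.
Variable R : realType.

Lemma gaps_cvg_infty (s t : nat -> R) : (forall n, s n < t n <= s n.+1) ->
  ~ bounded_fun s -> forall M : R, exists N, forall n, (N <= n)%N -> M < s n.
Proof.
move=> st bs M; apply: contrapT => /forallNP hM; apply: bs.
have mono : {homo s : m n / (m <= n)%N >-> m <= n}.
  apply/nondecreasing_seqP => n.
  by have /andP[/ltW] := st n; exact: le_trans.
have sM n : s n <= M.
  have /existsNP[m /not_implyP[nm /negP]] := hM n.
  by rewrite -leNgt; apply: le_trans; exact: mono.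
exists (Num.max `|s 0%N| `|M|); split; first exact: num_real.
move=> K; rewrite gt_max => /andP[K0 K1] n _ /=; rewrite ler_norml; apply/andP; split.
  apply: le_trans (mono 0%N n (leq0n n)).
  by have := ler_norm (- s 0%N); rewrite normrN; lra.
by apply: le_trans (sM n) _; have := ler_norm M; lra.
Qed.

Variables (a b g : R).
Hypotheses (a0 : 0 <= a) (b01 : 0 <= b < 1).

Lemma gap_ratio_b0 s t : b = 0 -> gap_ratio a b g s t = 2 * a / (t - s).
Proof.
move=> ->; rewrite /gap_ratio expr0n !mul0r !addr0 sqrtr_sqr ger0_norm//.
by congr (_ / _); ring.
Qed.

Let K := a ^+ 2 + b ^+ 2 * g ^+ 2.

Let K0 : 0 <= K.
Proof. by rewrite /K; have := sqr_ge0 a; have := mulr_ge0 (sqr_ge0 b) (sqr_ge0 g); lra. Qed.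

Lemma gap_ratio_lb s t : 0 < s -> s < t ->
  b * (s + t) <= gap_ratio a b g s t * (t - s).
Proof.
move=> s0 st; rewrite /gap_ratio divfK; last by rewrite lt0r_neq0// subr_gt0.
have := sqrt_rad_ge K0 b01 s; have := sqrt_rad_ge K0 b01 t.
rewrite /K !gtr0_norm//; last exact: lt_trans st.
by move=> *; rewrite mulrDr lerD.
Qed.

Lemma gap_ratio_ub s t : 0 < s -> s < t ->
  gap_ratio a b g s t * (t - s) <= 2 * Num.sqrt K + b * (s + t).
Proof.
move=> s0 st; rewrite /gap_ratio divfK; last by rewrite lt0r_neq0// subr_gt0.
have := sqrt_rad_lipschitz K0 b01 0 s; have := sqrt_rad_lipschitz K0 b01 0 t.
rewrite /K !subr0 expr0n mulr0 addr0 !gtr0_norm//; last exact: lt_trans st.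
lra.
Qed.

(** From b (s + t) < e (t - s).  The lower bound on t / s decreases in e and equals
    (1 + b) / (1 - b) at e = 1. *)
Lemma ratio_gt_of_gap_ratio_lt s t e : 0 < b -> 0 < s -> s < t -> e < 1 ->
  gap_ratio a b g s t < e -> b < e /\ (e + b) / (e - b) < t / s.
Proof.
move=> b0 s0 st e1 qe.
have ts : 0 < t - s by rewrite subr_gt0.
have h : b * (s + t) < e * (t - s).
  by apply: le_lt_trans (gap_ratio_lb s0 st) _; rewrite ltr_pM2r.
have be : b < e.
  rewrite -(ltr_pM2r ts); apply: le_lt_trans h; rewrite ler_pM2l//; lra.
split=> //; rewrite ltr_pdivrMr ?subr_gt0// mulrAC ltr_pdivlMr//; lra.
Qed.

(** The ratio is at most 2 sqrt(K) / (t - s) + b (t + s) / (t - s), whose first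
    term vanishes as [s] tends to infinity with t / s > l > 1. *)
Lemma gap_ratio_lt_of_ratio_gt l : (1 + b) / (1 - b) < l ->
  exists2 e, e < 1 & exists2 M : R, 0 < M & forall s t, M < s -> s < t -> l < t / s ->
    gap_ratio a b g s t < e.
Proof.
have /andP[b0 b1] := b01; have p0 : 0 < 1 - b by rewrite subr_gt0.
rewrite ltr_pdivrMr// => hl.
have l1 : 0 < l - 1.
  rewrite -(pmulr_lgt0 _ p0) mulrBl mul1r; lra.
pose e0 := b * (1 + l) / (l - 1).
have e01 : e0 < 1 by rewrite ltr_pdivrMr//; lra.
exists ((e0 + 1) / 2); first by lra.
pose d := (1 - e0) / 2; have d0 : 0 < d by rewrite /d; lra.
pose M := (2 * Num.sqrt K) / (d * (l - 1)) + 1.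
have M0 : 0 < M by rewrite ltr_wpDl// divr_ge0// mulr_ge0 ?sqrtr_ge0// ltW.
exists M => // s t Ms st lts.
have s0 : 0 < s := lt_trans M0 Ms.
have ts : 0 < t - s by rewrite subr_gt0.
have tsl : l * s < t by rewrite -ltr_pdivlMr.
have h1 : 2 * Num.sqrt K < d * (t - s).
  have : 2 * Num.sqrt K / (d * (l - 1)) < s by apply: lt_trans Ms; rewrite /M; lra.
  have dl : 0 < d * (l - 1) := mulr_gt0 d0 l1.
  rewrite ltr_pdivrMr// => /lt_trans; apply.
  by rewrite mulrCA ltr_pM2l//; lra.
have h2 : b * (s + t) <= e0 * (t - s).
  rewrite /e0 mulrAC ler_pdivlMr// -!mulrA ler_wpM2l//.
  rewrite -subr_ge0.
  have -> : (1 + l) * (t - s) - (s + t) * (l - 1) = 2 * (t - l * s) by ring.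
  by rewrite mulr_ge0// subr_ge0 ltW.
rewrite -(ltr_pM2r ts); apply: le_lt_trans (gap_ratio_ub s0 st) _.
by move: h1 h2; rewrite /d; lra.
Qed.

End GapRatio.

(** * Survival of spectral gaps *)

Section GapSurvives.
Variables (R : realType) (H : completeNormedModType R[i]).
Variable ip : {dot H for (@Num.conj R[i])}.
Hypothesis hip : inner_product_norm ip.
Variables (T A : operator H).
Hypotheses (normT : normal_op ip T) (linA : linear_op A) (TA : dom T `<=` dom A).
Variables (a b : R).
Hypothesis b01 : 0 <= b < 1.
Hypothesis hTA : forall x : H, dom T x ->
  `|A x| ^+ 2 <= (a ^+ 2)%:C * `|x| ^+ 2 + (b ^+ 2)%:C * `|T x| ^+ 2.

(** A spectral point [l] has its real part outside the gap and its imaginary part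
    at most the maximum in absolute value; with z in the strip, both facts give
    the hypothesis of [relbound_resolvent]. *)
Lemma gap_survives (g1 g2 s t : R) :
  spectrum T `<=` [set z | g1 <= complex.Im z <= g2] -> s < t ->
  vstrip s t `<=` resolvent_set T ->
  gap_ratio a b (Num.max `|g1| `|g2|) s t < 1 ->
  has_resolvent_strip (add_op T A) s t.
Proof.
move=> hspec st hgap hq.
have /andP[b0 b1] := b01.
set g := Num.max _ _ in hq.
pose K := a ^+ 2 + b ^+ 2 * g ^+ 2.
have K0 : 0 <= K.
  by rewrite /K; have := sqr_ge0 a; have := mulr_ge0 (sqr_ge0 b) (sqr_ge0 g); lra.
pose f m := Num.sqrt (K + b ^+ 2 * m ^+ 2).
have fs : 0 <= f s := sqrtr_ge0 _.
have ft : 0 <= f t := sqrtr_ge0 _.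
have ff : f s + f t < t - s.
  by move: hq; rewrite /gap_ratio ltr_pdivrMr ?subr_gt0// mul1r.
exists (s + f s), (t - f t); split; [by rewrite lerDl|lra|by rewrite gerBl|].
move=> z /= /andP[sz zt].
have [k [k1 kb hk]] := gap_margin K0 b01 sz zt.
apply: (relbound_resolvent hip normT linA TA hTA k1 b0 kb).
  by apply: hgap; apply/andP; split; lra.
move=> l lsp; apply: (@lt_le_trans _ _ ((complex.Re z - complex.Re l) ^+ 2)); last first.
  rewrite nrm_sqr !raddfB/= -[X in X <= _]sqrrN opprB lerDl sqr_ge0//.
apply: le_lt_trans (hk (complex.Re l) _); last first.
  have [|] := leP (complex.Re l) s; first by left.
  have [|lt sl] := leP t (complex.Re l); first by right.
  by case: lsp; apply: hgap; apply/andP.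
have k0 : 0 < k := lt_trans ltr01 k1.
rewrite ler_pM2l ?exprn_gt0// nrm_sqr /K -addrA lerD2l -mulrDr ler_wpM2l ?sqr_ge0//.
rewrite addrC lerD2r -[X in X <= _]real_normK ?num_real// ler_pXn2r ?nnegrE//; last first.
  by rewrite le_max normr_ge0.
have /andP[l1 l2] := hspec l lsp.
rewrite le_max !ler_norml; have [g10|g10] := leP 0 g1.
  apply/orP; right; rewrite ger0_norm; last by rewrite (le_trans g10) ?(le_trans l1).
  by rewrite l2 andbT; lra.
have [m0|m0] := leP 0 (complex.Im l).
  apply/orP; right; rewrite ger0_norm; last by rewrite (le_trans m0).
  by rewrite l2 andbT; lra.
apply/orP; left; rewrite ltr0_norm// opprK l1/=; lra.
Qed.

End GapSurvives.

Lemma infinite_of_frequently (P : set nat) :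
  (forall N, exists2 n, (N <= n)%N & P n) -> infinite_set P.
Proof.
move=> h /finite_seqP[F PF].
have [n nN Pn] := h (\max_(i <- F) i).+1.
have : n \in F by move: Pn; rewrite PF.
move=> nF; have nm : (n <= \max_(i <- F) i)%N by exact: leq_bigmax_seq.
by have := leq_ltn_trans nm nN; rewrite ltnn.
Qed.

Lemma finite_of_eventually (P : set nat) N :
  (forall n, (N <= n)%N -> ~ P n) -> finite_set P.
Proof.
move=> h; apply: (sub_finite_set _ (finite_II N)) => n Pn /=.
by rewrite ltnNge; apply/negP => /h.
Qed.

Theorem theorem5p4 (R : realType) (H : completeNormedModType R[i])
    (ip : {dot H for (@Num.conj R[i])}) (hip : inner_product_norm ip)
    (T A : operator H)
    (hT : normal_op ip T)
    (hA : linear_op A)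
    (hdom : dom T `<=` dom A)
    (a b : R) (ha : 0 <= a) (hb : 0 <= b < 1)
    (hTA : forall x : H, dom T x ->
       `|A x| ^+ 2 <= (a ^+ 2)%:C * `|x| ^+ 2 + (b ^+ 2)%:C * `|T x| ^+ 2)
    (gamma1 gamma2 : R) (hgamma : gamma1 < gamma2)
    (hspec : spectrum T `<=` [set z | gamma1 <= complex.Im z <= gamma2])
    (alpha beta : nat -> R)
    (halpha : ~ bounded_fun alpha) (hbeta : ~ bounded_fun beta)
    (hab : forall n, alpha n < beta n <= alpha n.+1)
    (hgap : forall n, vstrip (alpha n) (beta n) `<=` resolvent_set T) :
  let gamma := Num.max `|gamma1| `|gamma2| in
  let q n := gap_ratio a b gamma (alpha n) (beta n) in
  (* (i) *)
  [/\ (limn_einf (fun n => (q n)%:E) < 1)%E ->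
        infinite_set
          [set n | has_resolvent_strip (add_op T A) (alpha n) (beta n)],
      (* for a = b = 0 only one implication holds: then q n = 0 for all n,
         whereas the gap lengths may tend to 0 *)
      b = 0 ->
        ((limn_esup (fun n => (beta n - alpha n)%:E) > (2 * a)%:E)%E ->
           (limn_einf (fun n => (q n)%:E) < 1)%E) /\
        (0 < a ->
           (limn_einf (fun n => (q n)%:E) < 1)%E ->
           (limn_esup (fun n => (beta n - alpha n)%:E) > (2 * a)%:E)%E)
    & 0 < b ->
        ((limn_einf (fun n => (q n)%:E) < 1)%E <->
         (limn_esup (fun n => (beta n / alpha n)%:E)
            > ((1 + b) / (1 - b))%:E)%E)]
  /\
  (* (ii) *)
  [/\ (limn_esup (fun n => (q n)%:E) < 1)%E ->
        finite_set
          [set n | ~ has_resolvent_strip (add_op T A) (alpha n) (beta n)],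
      b = 0 ->
        ((limn_einf (fun n => (beta n - alpha n)%:E) > (2 * a)%:E)%E ->
           (limn_esup (fun n => (q n)%:E) < 1)%E) /\
        (0 < a ->
           (limn_esup (fun n => (q n)%:E) < 1)%E ->
           (limn_einf (fun n => (beta n - alpha n)%:E) > (2 * a)%:E)%E)
    & 0 < b ->
        ((limn_esup (fun n => (q n)%:E) < 1)%E <->
         (limn_einf (fun n => (beta n / alpha n)%:E)
            > ((1 + b) / (1 - b))%:E)%E)].
Proof.
move=> gamma q.
have st n : alpha n < beta n by have /andP[] := hab n.
have ts n : 0 < beta n - alpha n by rewrite subr_gt0.
have ainf := gaps_cvg_infty hab halpha.
have surv n : q n < 1 -> has_resolvent_strip (add_op T A) (alpha n) (beta n).
  exact: (gap_survives hip hT hA hdom hb hTA hspec (st n) (hgap n)).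
(* Each equivalence reduces to transferring a strict bound, with a uniform
   margin, between q n and the gap length or the quotient of the end points. *)
have len_q : b = 0 -> forall l, 2 * a < l ->
    exists2 e, e < 1 & forall n, l < beta n - alpha n -> q n < e.
  move=> b0 l l2a; have l0 : 0 < l by lra.
  have [e e1 e2] : exists2 e, e < 1 & 2 * a < e * l.
    exists ((2 * a / l + 1) / 2).
      by have : 2 * a / l < 1; [rewrite ltr_pdivrMr// mul1r | lra].
    have -> : (2 * a / l + 1) / 2 * l = (2 * a + l) / 2 by field; exact: lt0r_neq0.
    by lra.
  exists e => // n ln; rewrite /q gap_ratio_b0// ltr_pdivrMr//.
  apply: (lt_trans e2); rewrite ltr_pM2l//.
  by rewrite -(pmulr_lgt0 _ l0) (le_lt_trans _ e2)// mulr_ge0.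
have q_len : b = 0 -> 0 < a -> forall e, e < 1 ->
    exists2 l, 2 * a < l & forall n, q n < e -> l < beta n - alpha n.
  move=> b0 a0 e e1; pose e' := Num.max e 2^-1.
  have e'0 : 0 < e' by rewrite lt_max invr_gt0 ltr0n orbT.
  have e'1 : e' < 1 by rewrite gt_max e1; lra.
  exists (2 * a / e'); first by rewrite ltr_pdivlMr// gtr_pMr// mulr_gt0.
  move=> n qe; have : q n < e' by apply: lt_le_trans qe _; rewrite le_max lexx.
  by rewrite /q gap_ratio_b0// !ltr_pdivrMr// [_ * e']mulrC.
have rat_q l : (1 + b) / (1 - b) < l -> exists2 e, e < 1 & exists N, forall n,
    (N <= n)%N -> l < beta n / alpha n -> q n < e.
  move=> /(gap_ratio_lt_of_ratio_gt a gamma hb)[e e1 [M M0 hM]]; exists e => //.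
  have [N hN] := ainf M; exists N => n Nn; apply: hM => //; exact: hN.
have q_rat : 0 < b -> forall e, e < 1 -> exists2 l, (1 + b) / (1 - b) < l &
    exists N, forall n, (N <= n)%N -> q n < e -> l < beta n / alpha n.
  move=> b0 e e1; have /andP[_ b1] := hb.
  have [N hN] := ainf 0.
  have [be|eb] := ltP b e.
    exists ((e + b) / (e - b)).
      by rewrite ltr_pdivlMr ?subr_gt0// mulrAC ltr_pdivrMr ?subr_gt0//; nra.
    exists N => n Nn qe.
    by have [] := ratio_gt_of_gap_ratio_lt hb b0 (hN n Nn) (st n) e1 qe.
  (* If e <= b, then q n < e is impossible, and any l will do. *)
  exists ((1 + b) / (1 - b) + 1); first by rewrite ltrDl.
  exists N => n Nn qe.
  have [] := ratio_gt_of_gap_ratio_lt hb b0 (hN n Nn) (st n) e1 qe.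
  by rewrite ltNge eb.
split; split.
- move=> /limn_einf_ltP[e e1 he]; apply: infinite_of_frequently => N.
  have [n Nn qe] := he N; exists n => //=; apply: surv; exact: lt_trans e1.
- move=> b0; split.
    move=> /limn_esup_gtP[l l2a hl]; have [e e1 he] := len_q b0 l l2a.
    apply/limn_einf_ltP; exists e => // N; have [n Nn ln] := hl N.
    by exists n => //; exact: he.
  move=> a0 /limn_einf_ltP[e e1 he]; have [l l2a hl] := q_len b0 a0 e e1.
  apply/limn_esup_gtP; exists l => // N; have [n Nn qe] := he N.
  by exists n => //; exact: hl.
- move=> b0; split.
    move=> /limn_einf_ltP[e e1 he]; have [l l2a [M hl]] := q_rat b0 e e1.
    apply/(limn_esup_gtP (fun n => beta n / alpha n)); exists l => // N.
    have [n] := he (maxn M N); rewrite geq_max => /andP[Mn Nn] qe.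
    by exists n => //; exact: hl.
  move=> /(limn_esup_gtP (fun n => beta n / alpha n))[l lb hl].
  have [e e1 [M he]] := rat_q l lb.
  apply/limn_einf_ltP; exists e => // N.
  have [n] := hl (maxn M N); rewrite geq_max => /andP[Mn Nn] ln.
  by exists n => //; exact: he.
- move=> /limn_esup_ltP[e e1 [N he]]; apply: (@finite_of_eventually _ N) => n Nn /=.
  apply; apply: surv; apply: lt_trans e1; exact: he.
- move=> b0; split.
    move=> /limn_einf_gtP[l l2a [N hl]]; have [e e1 he] := len_q b0 l l2a.
    by apply/limn_esup_ltP; exists e => //; exists N => n /hl; exact: he.
  move=> a0 /limn_esup_ltP[e e1 [N he]]; have [l l2a hl] := q_len b0 a0 e e1.
  by apply/limn_einf_gtP; exists l => //; exists N => n /he; exact: hl.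
- move=> b0; split.
    move=> /limn_esup_ltP[e e1 [N he]]; have [l l2a [M hl]] := q_rat b0 e e1.
    apply/(limn_einf_gtP (fun n => beta n / alpha n)); exists l => //.
    exists (maxn M N) => n; rewrite geq_max => /andP[Mn Nn].
    by apply: hl => //; exact: he.
  move=> /(limn_einf_gtP (fun n => beta n / alpha n))[l lb [N hl]].
  have [e e1 [M he]] := rat_q l lb.
  apply/limn_esup_ltP; exists e => //.
  exists (maxn M N) => n; rewrite geq_max => /andP[Mn Nn].
  by apply: he => //; exact: hl.
Qed.
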